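(* Consider Problem P1, with O1 using a policy given by thresholds $(\alpha^1_t,\beta^1_t,\delta^1_t,\theta^1_t)$ at times $t=1,\dots,T^1-1$ and a threshold $\alpha^1_{T^1}$ at time $T^1$, and O2 using the optimal Wald policy after it receives O1's final message. For $t=1,2,\dots,T^1-1$, there exist functions $\mathcal{R}_t(\xi_t,\alpha^1_t,\beta^1_t,\delta^1_t,\theta^1_t)$ and $\mathcal{R}^*_t(\xi_t)$ where $$\mathcal{R}^*_t(\xi_t)=\inf_{\alpha^1_t,\beta^1_t,\delta^1_t,\theta^1_t}\mathcal{R}_t(\xi_t,\alpha^1_t,\beta^1_t,\delta^1_t,\theta^1_t),$$ and for $t=T^1$ there exist functions $\mathcal{R}_{T^1}(\xi_{T^1},\alpha^1_{T^1})$ and $\mathcal{R}^*_{T^1}(\xi_{T^1})$ where $$\mathcal{R}^*_{T^1}(\xi_{T^1})=\inf_{\alpha^1_{T^1}}\mathcal{R}_{T^1}(\xi_{T^1},\alpha^1_{T^1}),$$ such that the optimal thresholds can be evaluated from these functions as follows: 1. $\xi_1:=P(H,\pi^1_1)$ is fixed a priori and does not depend on any design choice. The optimal thresholds at $t=1$ for O1 are given by the optimizing parameters in the definition of $\mathcal{R}^*_1(\xi_1)$. 2. Once O1's thresholds at $t=1$ are fixed, $\eta_1[b]$ and hence $\xi_2$ are fixed. The optimal thresholds for O1 at time $t=2$ are given by the optimizing parameters in the definition of $\mathcal{R}^*_2(\xi_2)$. 3. Continuing sequentially, $\xi_t$ is fixed by the choice of past thresholds, and the optimal thresholds for O1 at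 time $t$ are given by the optimizing parameters in the definition of $\mathcal{R}^*_t(\xi_t)$.
   Context: **Model.** $H\in\{0,1\}$ is random with known prior $P(H=0)=p_0$, $P(H=1)=1-p_0$. There are two observers O1, O2. $Y^i_t\in\mathcal{Y}^i$ is the observation of O$i$ at time $t$; given $H$, it has either a discrete distribution $P^i_t(\cdot|H)$ or a density $f^i_t(\cdot|H)$. Given $H$, the observations of each observer at different times are independent, and the two observation sequences are independent. $X_{1:t}$ denotes $X_1,\dots,X_t$; $b$ is a blank message and $b_{1:t}$ a sequence of $t$ blanks. **O1.** As long as it has not sent a final message, at time $t$ O1 chooses $Z^1_t=\gamma^1_t(Y^1_{1:t})\in\{0,1,b\}$; $\tau^1=\min\{t: Z^1_t\in\{0,1\}\}\le T^1<\infty$ (at time $T^1$ it must send $0$ or $1$ if it has not done so before). O1's belief is $\pi^1_t=P(H=0|Y^1_{1:t})$. **Problem P1.** O2 waits for O1's final message and only then takes its own measurements: after $k=0,1,2,\dots$ measurements it chooses $U^2_k=\gamma^2_k(Y^2_{1:k},Z^1_{1:\tau^1})\in\{0,1,N\}$ ($N$ = continue); $\tau^2=\min\{k:U^2_k\in\{0,1\}\}\le T^2<\infty$. The objective is to minimize $\mathbb{E}^{\Gamma^1,\Gamma^2}\{c^1\tau^1+c^2\tau^2+J(U^2_{\tau^2},H)\}$ over $\Gamma^1=(\gamma^1_1,\dots,\gamma^1_{T^1})$, $\Gamma^2=(\gamma^2_0,\dots,\gamma^2_{T^2})$, where $c^1,c^2$ are finite positive numbers, $0\le J\le L<\infty$,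 $J(0,1)>J(1,1)$, $J(1,0)>J(0,0)$. **Wald policy of O2.** After O1's final message, O2 has belief $\pi^2_0=P^{\Gamma^1}(H=0|Z^1_{1:\tau^1})$ and faces the classical centralized sequential detection (Wald) problem with prior $\pi^2_0$, at most $T^2$ measurements, cost $c^2$ per measurement and terminal cost $J$; the optimal Wald policy is an optimal policy for that problem. **Threshold policies of O1.** For $t\le T^1-1$ (with $0\le\alpha^1_t\le\beta^1_t\le\delta^1_t\le\theta^1_t\le1$): $Z^1_t=1$ if $\alpha^1_t\le\pi^1_t\le\beta^1_t$; $Z^1_t=0$ if $\delta^1_t\le\pi^1_t\le\theta^1_t$; $Z^1_t=b$ otherwise. At $T^1$ (with $0\le\alpha^1_{T^1}\le1$): $Z^1_{T^1}=1$ if $\pi^1_{T^1}\le\alpha^1_{T^1}$, and $0$ otherwise. **Information states.** Given O1's decision functions $\Gamma^1_{t-1}=(\gamma^1_1,\dots,\gamma^1_{t-1})$, $\xi_t:=P^{\Gamma^1_{t-1}}(H,\pi^1_t\,|\,Z^1_{1:t-1}=b_{1:t-1})$ is the conditional joint law of $(H,\pi^1_t)$, $t=1,\dots,T^1$. Given $\Gamma^1_t=(\gamma^1_1,\dots,\gamma^1_t)$, $\eta_t[z]:=P^{\Gamma^1_t}(H,\pi^1_t\,|\,Z^1_{1:t-1}=b_{1:t-1},Z^1_t=z)$ for $z\in\{0,1,b\}$. The law $\eta_t[z]$ is determined by $\xi_t$, the thresholds at time $t$, and $z$; the law $\xi_{t+1}$ is determined by $\eta_t[b]$. ''Optimizing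 parameters'' are parameters attaining the infimum. *)

(* Defs.v *)
From HB Require Import structures.
From mathcomp Require Import all_boot all_order all_algebra.
From mathcomp Require Import all_classical all_reals all_analysis.

Set Implicit Arguments.
Unset Strict Implicit.
Unset Printing Implicit Defensive.
Import Order.TTheory GRing.Theory Num.Theory.

Local Open Scope classical_set_scope.
Local Open Scope ring_scope.

(* Hypotheses and final decisions are booleans, 0 being [false] and 1 being
   [true].  Messages of O1 and decisions of O2 are of type [option bool], the
   blank b (for O1) and "continue" N (for O2) being [None]. *)

Section joint_law.
Context d (Omega : measurableType d) (R : realType).
Variables (law : bool -> probability Omega R) (p : R).

(* Joint law of the hypothesis and of the observations when P(H = 0) = p and
   [law h] is the conditional law given H = h.  The hypothesis is the first
   coordinate of a sample point (h, w). *)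
Definition joint (A : set (bool * Omega)) : \bar R :=
  (\int[bernoulli_prob (1 - p)]_h law h (xsection A h))%E.

Let joint0 : joint set0 = 0%E.
Proof.
by rewrite /joint; apply: integral0_eq => h _; rewrite xsection0 measure0.
Qed.

Let joint_ge0 A : (0 <= joint A)%E.
Proof. by apply: integral_ge0 => h _; exact: measure_ge0. Qed.

Let joint_sigma_additive : semi_sigma_additive joint.
Proof.
move=> F mF tF mUF.
have -> : joint (\bigcup_n F n) = (\sum_(n <oo) joint (F n))%E.
  rewrite /joint -integral_nneseries//=.
  apply: eq_integral => h _; rewrite xsection_bigcup.
  rewrite measure_semi_bigcup//=.
  - by move=> i; exact: measurable_xsection.
  - exact: trivIset_xsection.
  - by rewrite -xsection_bigcup; exact: measurable_xsection.
by apply: is_cvg_nneseries => n _ _; exact: joint_ge0.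
Qed.

HB.instance Definition _ :=
  isMeasure.Build _ _ _ joint joint0 joint_ge0 joint_sigma_additive.

Let joint_setT : joint setT = 1%E.
Proof.
rewrite /joint (eq_integral (cst 1%E)) => [|h _]; last first.
  by rewrite xsectionE probability_setT.
by rewrite integral_cst//= mul1e; exact: (@probability_setT _ _ _ (bernoulli_prob _)).
Qed.

HB.instance Definition _ :=
  Measure_isProbability.Build _ _ _ joint joint_setT.

End joint_law.

(* The conditional laws of [X] given H = 0 and H = 1 have densities with respect
   to a common sigma-finite measure: a counting measure in the case of discrete
   distributions, Lebesgue measure in the case of densities on R^n. *)
Definition has_densities d d' (Omega : measurableType d) (Y : measurableType d')
    (R : realType) (law : bool -> probability Omega R) (X : Omega -> Y) : Prop :=
  exists (mu : {sigma_finite_measure set Y -> \bar R}) (f : bool -> Y -> R),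
    forall h, [/\ measurable_fun setT (f h), forall y, 0 <= f h y &
      forall A, measurable A ->
        law h (X @^-1` A) = (\int[mu]_(y in A) (f h y)%:E)%E].

(* [obs1 t] and [obs2 t] are the observations at times t = 1, 2, ...; [obs1 0]
   and [obs2 0] are not used. *)
Record model (R : realType) d d1 d2 (Omega : measurableType d)
    (Y1 : measurableType d1) (Y2 : measurableType d2) := Model {
  prior : R;
  law : bool -> probability Omega R;
  obs1 : nat -> Omega -> Y1;
  obs2 : nat -> Omega -> Y2;
  T1 : nat;
  T2 : nat;
  c1 : R;
  c2 : R;
  (* [J u h] is the cost of the final decision u when H = h. *)
  J : bool -> bool -> R;
  L : R;
  prior01 : 0 <= prior <= 1;
  measurable_obs1 : forall t, (1 <= t <= T1)%N -> measurable_fun setT (obs1 t);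
  measurable_obs2 : forall t, (1 <= t <= T2)%N -> measurable_fun setT (obs2 t);
  densities_obs1 : forall t, (1 <= t <= T1)%N -> has_densities law (obs1 t);
  densities_obs2 : forall t, (1 <= t <= T2)%N -> has_densities law (obs2 t);
  (* Mutual independence given H of all the observations of both observers. *)
  cond_independent_obs : forall h (A : nat -> set Y1) (B : nat -> set Y2),
    (forall t, measurable (A t)) -> (forall t, measurable (B t)) ->
    law h [set w | (forall t, (1 <= t <= T1)%N -> A t (obs1 t w)) /\
                   (forall t, (1 <= t <= T2)%N -> B t (obs2 t w))] =
    ((\prod_(1 <= t < T1.+1) law h (obs1 t @^-1` A t)) *
     (\prod_(1 <= t < T2.+1) law h (obs2 t @^-1` B t)))%E;
  T1_gt0 : (0 < T1)%N;
  c1_gt0 : 0 < c1;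
  c2_gt0 : 0 < c2;
  J_bounded : forall u h, 0 <= J u h <= L;
  J_1 : J true true < J false true;
  J_0 : J false false < J true false }.

Record thresholds (R : realType) :=
  Thresholds { alpha : R; beta : R; delta : R; theta : R }.

Definition ordered (R : realType) (a : thresholds R) : Prop :=
  [/\ 0 <= alpha a, alpha a <= beta a, beta a <= delta a,
      delta a <= theta a & theta a <= 1].

(* When beta = delta, the message at this common value is 1. *)
Definition threshold_message (R : realType) (a : thresholds R) (p : R) :
    option bool :=
  if alpha a <= p <= beta a then Some true
  else if delta a <= p <= theta a then Some false
  else None.

(* [thr g t] is used at times 1 <= t < T1 and [last_thr g] at time T1. *)
Record policy1 (R : realType) :=
  Policy1 { thr : nat -> thresholds R; last_thr : R }.

(* Laws of pairs (hypothesis, belief), as set functions. *)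
Definition joint_law_type (R : realType) := set (bool * R) -> R.

Section problem.
Context (R : realType) d d1 d2 (Omega : measurableType d)
  (Y1 : measurableType d1) (Y2 : measurableType d2).
Variable M : model R Omega Y1 Y2.
Local Notation P := (joint (law M) (prior M)).

Definition hist1 t (w : Omega) : t.-tuple Y1 := [tuple obs1 M i.+1 w | i < t].
Definition hist2 k (w : Omega) : k.-tuple Y2 := [tuple obs2 M i.+1 w | i < k].

(* [pi t] is a version of y |-> P(H = 0 | Y^1_{1:t} = y). *)
Definition is_belief1 (pi : forall t, t.-tuple Y1 -> R) : Prop :=
  forall t, (1 <= t <= T1 M)%N ->
  [/\ measurable_fun setT (pi t), forall y, 0 <= pi t y <= 1 &
    forall B, measurable B ->
      (\int[P]_(x in [set x | B (hist1 t x.2)]) (pi t (hist1 t x.2))%:E)%E =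
      P [set x | x.1 = false /\ B (hist1 t x.2)]].

(* Policies for the second observer once its prior belief is fixed. *)
Definition policy2 := forall k, k.-tuple Y2 -> option bool.

Definition admissible2 (u : policy2) : Prop :=
  (forall k (v : option bool), (k <= T2 M)%N ->
     measurable [set y : k.-tuple Y2 | u k y = v]) /\
  (forall y, u (T2 M) y <> None).

Definition tau2 (u : policy2) (w : Omega) : nat :=
  find (fun k => isSome (u k (hist2 k w))) (iota 0 (T2 M).+1).

Definition decision2 (u : policy2) (w : Omega) : bool :=
  odflt false (u (tau2 u w) (hist2 (tau2 u w) w)).

Definition wald_cost (p : R) (u : policy2) : \bar R :=
  (\int[joint (law M) p]_x
     (c2 M * (tau2 u x.2)%:R + J M (decision2 u x.2) x.1)%:E)%E.

Definition wald_optimal (p : R) (u : policy2) : Prop :=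
  admissible2 u /\
  forall u', admissible2 u' -> (wald_cost p u <= wald_cost p u')%E.

Definition is_wald_policy (wald : R -> policy2) : Prop :=
  forall p, 0 <= p <= 1 -> wald_optimal p (wald p).

Definition admissible1 (g : policy1 R) : Prop :=
  (forall t, (1 <= t < T1 M)%N -> ordered (thr g t)) /\ 0 <= last_thr g <= 1.

Section first_observer.
Variable pi : forall t, t.-tuple Y1 -> R.

Definition belief1 t (x : bool * Omega) : R := pi (hist1 t x.2).

Definition message (g : policy1 R) t (x : bool * Omega) : option bool :=
  if (t < T1 M)%N then threshold_message (thr g t) (belief1 t x)
  else Some (belief1 t x <= last_thr g).

Definition tau1 g (x : bool * Omega) : nat :=
  (find (fun t => isSome (message g t x)) (iota 1 (T1 M))).+1.

(* Z^1_{1:tau^1} *)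
Definition transcript g (x : bool * Omega) : seq (option bool) :=
  [seq message g t x | t <- iota 1 (tau1 g x)].

(* The belief pi^2_0 of O2 when it has received the messages [z]; equal to 0
   when [z] has probability zero. *)
Definition belief2 g (z : seq (option bool)) : R :=
  fine (P [set x | x.1 = false /\ transcript g x = z]) /
  fine (P [set x | transcript g x = z]).

Definition expected_cost g (gamma2 : seq (option bool) -> policy2) : \bar R :=
  (\int[P]_x
     (c1 M * (tau1 g x)%:R + c2 M * (tau2 (gamma2 (transcript g x)) x.2)%:R +
      J M (decision2 (gamma2 (transcript g x)) x.2) x.1)%:E)%E.

Definition cost (wald : R -> policy2) g : \bar R :=
  expected_cost g (fun z => wald (belief2 g z)).

(* Z^1_{1:t} = b_{1:t} *)
Definition blanks g t : set (bool * Omega) :=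
  [set x | forall s, (1 <= s <= t)%N -> message g s x = None].

(* Law of (H, pi^1_t) given an event [E], meaningful when [E] has positive
   probability.  It is set to 0 on non-measurable sets, so that two such laws
   are equal as functions as soon as they agree on measurable sets. *)
Definition cond_law (E : set (bool * Omega)) t : joint_law_type R :=
  fun A => if `[< measurable A >] then
    fine (P (E `&` [set x | A (x.1, belief1 t x)])) / fine (P E) else 0.

Definition xi_law g t : joint_law_type R := cond_law (blanks g t.-1) t.

Definition eta_law g t (z : option bool) : joint_law_type R :=
  cond_law (blanks g t.-1 `&` [set x | message g t x = z]) t.

(* The time t is reached without final message with positive probability, so
   that the conditioning event of xi_t is not negligible. *)
Definition reachable g t : Prop := (0 < P (blanks g t.-1))%E.

Definition same_past (g g' : policy1 R) t : Prop :=
  forall s, (1 <= s < t)%N -> thr g s = thr g' s.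

(* The thresholds of [g] at times t, ..., T1 are optimal, its thresholds at
   times s < t being fixed. *)
Definition optimal_from wald g t : Prop :=
  admissible1 g /\
  forall g', admissible1 g' -> same_past g g' t ->
    (cost wald g <= cost wald g')%E.

End first_observer.

End problem.

(* Main.v *)
Require Import Defs.
From HB Require Import structures.
From mathcomp Require Import all_boot all_order all_algebra.
From mathcomp Require Import all_classical all_reals all_analysis.
From mathcomp Require Import measurable_realfun.
Import Order.TTheory GRing.Theory Num.Theory.
Local Open Scope classical_set_scope.
Local Open Scope ring_scope.

(** The thresholds of O1 are found by dynamic programming, with the conditional
joint law of the hypothesis and of the current belief of O1, given that O1 has
been silent so far, as the state.

Two facts make this law a state.  First, it evolves autonomously: a threshold
rule selects the message from the belief alone, so that conditioning on the
message only restricts the law ([cond_law_filter], [eta_lawE]); and by Bayes'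
rule the next belief is almost surely a fixed function of the current belief and
of the next observation ([bayes_rule], [belief_update]), while that observation
is independent of the past given the hypothesis.  The law of (hypothesis, belief,
next observation) given silence is therefore a product which depends on the past
only through the state, and the next state is its image ([xi_law_eta]).

Secondly, the state determines the costs.  If O1 stops at time s with message z,
O2 starts from the belief P(H = 0 | b, ..., b, z), which is read off the state
and the thresholds of time s; and as O2's observations are independent of O1's
given the hypothesis, the mean cost of what follows is a function of s and of
this belief.  Summing over s and z gives [cost_decomposition], in which only the
terms with s >= t involve the thresholds from time t on.  Their sum, normalized
by the probability of reaching t, is the cost to go; it satisfies the recursion
[cost_to_go_step] and depends only on the state at t and on the later thresholds
([cost_to_go_future]).

The cost attached to a state l and to thresholds a is then the infimum of the
cost to go over all admissible policies which reach time t in the state l and use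
a there, and its infimum over a is the optimal cost.  A policy has minimal cost to
go among all policies in its state exactly when its current thresholds attain the
infimum and, if the next time is reached with positive probability, its cost to go
there is minimal as well ([optimal_given_state_step]): splicing the past of one
policy with the future of another changes neither the state nor the cost to go.
Iterating up to the last time gives the theorem.  Optimality among the policies
with a given past is the same as optimality in the state, because every policy in
that state can be spliced onto the given past ([optimal_from_state]). *)

Set Implicit Arguments.
Unset Strict Implicit.
Unset Printing Implicit Defensive.

(** * Measure-theoretic preliminaries *)

Lemma measurable_preimageT d1 d2 (T1 : measurableType d1) (T2 : measurableType d2)
    (f : T1 -> T2) B : measurable_fun setT f -> measurable B ->
  measurable (f @^-1` B).
Proof. by move=> mf mB; rewrite -[X in measurable X]setTI; exact: mf. Qed.

Section measure_tools.
Context d (T : measurableType d) (R : realType).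

Lemma fin_prob (P : probability T R) A : measurable A -> P A \is a fin_num.
Proof. by move=> mA; exact: fin_num_measure. Qed.

(** Both sides are finite measures in [C], so that Dynkin's uniqueness theorem
extends the product rule from a pi-system to the sigma-algebra it generates. *)
Lemma indep_g_sigma (P : probability T R) (G : set (set T)) (E : set T) :
  setI_closed G -> G `<=` measurable -> G setT -> measurable E ->
  (forall C, G C -> P (C `&` E) = (P C * P E)%E) ->
  forall C, <<s G >> C -> P (C `&` E) = (P C * P E)%E.
Proof.
move=> GI Gm GT mE indep C sC.
have fE0 : 0 <= fine (P E) by rewrite fine_ge0.
rewrite -[P E]fineK ?fin_prob// muleC.
apply: (g_sigma_algebra_measure_unique G Gm (fun=> setT) _ _
  (mrestr P mE) (mscale (NngNum fE0) P)) => //.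
- by rewrite bigcup_const.
- by move=> A GA; rewrite /= /mrestr /mscale/= indep// fineK ?fin_prob// muleC.
- by move=> k; rewrite /= /mrestr ltey_eq fin_prob//; exact: measurableI.
Qed.

(** Costs are functions of finitely many labels (stopping times, decisions and
hypothesis); this turns their expectations into finite sums of probabilities, to
which independence applies directly. *)
Lemma integral_finite_range (P : probability T R) (I : finType) (l : T -> I)
    (v : I -> R) :
  (forall i, measurable (l @^-1` [set i])) -> (forall i, 0 <= v i) ->
  (\int[P]_x (v (l x))%:E)%E =
  (\sum_i v i * fine (P (l @^-1` [set i])))%:E.
Proof.
move=> ml v0.
transitivity (\int[P]_x (\sum_i (v i)%:E * (\1_(l @^-1` [set i]) x)%:E))%E.
  apply: eq_integral => x _; rewrite (bigD1 (l x))//= big1 ?adde0.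
    by rewrite indicE mem_set// mule1.
  move=> i il; rewrite indicE memNset ?mule0// => /= lx.
  by rewrite lx eqxx in il.
rewrite ge0_integral_sum//.
- rewrite -sumEFin; apply: eq_bigr => i _.
  rewrite ge0_integralZl ?lee_fin//; last first.
    by apply/measurable_EFinP; exact: measurable_indic.
  by rewrite integral_indic// setIT EFinM fineK// fin_prob.
- move=> i; apply: emeasurable_funM => //.
  by apply/measurable_EFinP; exact: measurable_indic.
- by move=> i x _; rewrite mule_ge0 ?lee_fin.
Qed.

Import HBNNSimple.

(** The identity holds for indicators by hypothesis, hence for simple functions,
and passes to the limit by monotone convergence. *)
Lemma ge0_integral_density (mu nu : {measure set T -> \bar R}) (f : T -> R)
    (F : T -> \bar R) :
  measurable_fun setT f -> (forall y, 0 <= f y) ->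
  (forall A, measurable A -> nu A = (\int[mu]_(y in A) (f y)%:E)%E) ->
  measurable_fun setT F -> (forall y, 0 <= F y)%E ->
  (\int[nu]_y F y = \int[mu]_y (F y * (f y)%:E))%E.
Proof.
move=> mf f0 nuE mF F0; have mfE : measurable_fun setT (EFin \o f).
  exact/measurable_EFinP.
pose h := nnsfun_approx measurableT mF.
have hF x : (EFin \o h n) x @[n --> \oo] --> F x.
  by apply: cvg_nnsfun_approx => // y _; exact: F0.
have mh n : measurable_fun setT (EFin \o h n) by exact/measurable_EFinP.
have ndh x : nondecreasing_seq (fun n => (EFin \o h n) x).
  by move=> a b ab; rewrite lee_fin; exact/lefP/nd_nnsfun_approx.
transitivity (limn (fun n => \int[nu]_x (EFin \o h n) x))%E.
  rewrite -monotone_convergence//.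
  - by apply: eq_integral => x _; apply/esym/cvg_lim => //; exact: hF.
  - by move=> n x _; rewrite lee_fin.
transitivity (limn (fun n => \int[mu]_x ((EFin \o h n) x * (f x)%:E)))%E; last first.
  rewrite -monotone_convergence//.
  - apply: eq_integral => x _; apply/cvg_lim => //.
    by apply: cvgeZr => //; exact: hF.
  - by move=> n; exact: emeasurable_funM.
  - by move=> n x _; rewrite mule_ge0 ?lee_fin.
  - by move=> x _ a b ab; rewrite lee_wpmul2r ?lee_fin//; exact/lefP/nd_nnsfun_approx.
congr (limn _); apply/funext => n.
have mi y : measurable_fun setT (fun x => (y * \1_(h n @^-1` [set y]) x)%:E).
  by apply/measurable_EFinP; exact: measurable_funM.
transitivity (\int[nu]_x (\sum_(y \in range (h n)) (y * \1_(h n @^-1` [set y]) x)%:E))%E.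
  by apply: eq_integral => x _; rewrite /= fimfunE -fsumEFin.
rewrite ge0_integral_fsum//; last by move=> y x _; exact: nnfun_muleindic_ge0.
transitivity (\int[mu]_x (\sum_(y \in range (h n))
    ((y * \1_(h n @^-1` [set y]) x)%:E * (f x)%:E)))%E; last first.
  apply: eq_integral => x _.
  rewrite -ge0_mule_fsuml => [|y]; last exact: nnfun_muleindic_ge0.
  by rewrite fsumEFin // -(fimfunE _ x).
rewrite ge0_integral_fsum//; last 2 first.
  - by move=> y; exact: emeasurable_funM.
  - by move=> y x _; rewrite mule_ge0 ?lee_fin//; exact: nnfun_muleindic_ge0.
apply: eq_fsbigr => r; rewrite inE => -[t _ rE].
have r0 : 0 <= r by rewrite -rE.
under eq_integral do rewrite EFinM.
rewrite integralZl_indic_nnsfun => //.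
under [RHS]eq_integral do rewrite EFinM -muleA.
rewrite ge0_integralZl//; last 2 first.
  - by apply: emeasurable_funM => //; exact/measurable_EFinP.
  - by move=> x _; rewrite mule_ge0 ?lee_fin.
rewrite integral_indic// setIT; congr (_ * _)%E.
rewrite nuE// integral_mkcond.
by apply: eq_integral => x _; rewrite epatch_indic/= muleC.
Qed.

End measure_tools.

Definition cylinders (Omega : Type) d (Y : measurableType d)
    (X : nat -> Omega -> Y) n : set (set Omega) :=
  [set C | exists2 A : nat -> set Y, (forall t, measurable (A t)) &
     C = [set w | forall t, (1 <= t <= n)%N -> A t (X t w)]].

Section cylinders.
Context d (Omega : measurableType d) d' (Y : measurableType d').
Variables (X : nat -> Omega -> Y).

(** The sample space with the sigma-algebra generated by [X 1, ..., X n]: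
measurability in this type means being determined by these observations. *)
Definition history n := g_sigma_algebraType (cylinders X n).

Lemma cylindersT n : cylinders X n setT.
Proof. by exists (fun=> setT) => //; apply/seteqP; split. Qed.

Lemma cylindersI n : setI_closed (cylinders X n).
Proof.
move=> _ _ [A mA ->] [B mB ->]; exists (fun t => A t `&` B t).
  by move=> t; exact: measurableI.
by apply/seteqP; split=> [w [/= HA HB] t /[dup] /HA ? /HB|w /= H]//;
  split=> t /H [].
Qed.

Lemma cylinders1 n t C : (1 <= t <= n)%N -> measurable C ->
  cylinders X n (X t @^-1` C).
Proof.
move=> tn mC; exists (fun s => if s == t then C else setT).
  by move=> s; case: ifP.
apply/seteqP; split=> [w /= Cw s _|w /= /(_ t tn)]; last by rewrite eqxx.
by case: eqP => // ->.
Qed.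

Lemma measurable_history_obs n t : (1 <= t <= n)%N ->
  measurable_fun setT (X t : history n -> Y).
Proof.
move=> tn _ C mC; rewrite setTI.
by apply: sub_sigma_algebra; exact: cylinders1.
Qed.

Lemma measurable_history_tuple n t : (t <= n)%N ->
  measurable_fun setT ((fun w => [tuple X i.+1 w | i < t]) : history n -> t.-tuple Y).
Proof.
move=> tn; apply/measurable_fun_tnthP => i.
rewrite (_ : _ \o _ = X i.+1); last by apply/funext => w /=; rewrite tnth_mktuple.
by apply: measurable_history_obs; rewrite /= (leq_trans _ tn).
Qed.

End cylinders.

Section cylinders_measurable.
Context d (Omega : measurableType d) d' (Y : measurableType d').
Variables (X : nat -> Omega -> Y) (n : nat).
Hypothesis mX : forall t, (1 <= t <= n)%N -> measurable_fun setT (X t).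

Lemma measurable_cylinders : cylinders X n `<=` measurable.
Proof.
move=> _ [A mA ->].
rewrite (_ : mkset _ = \bigcap_t [set w | (1 <= t <= n)%N -> A t (X t w)]).
  apply: bigcapT_measurable => t.
  have [tn|tn] := boolP (1 <= t <= n)%N.
    rewrite (_ : mkset _ = X t @^-1` A t).
      by rewrite -[X in measurable X]setTI; exact: mX.
    by apply/seteqP; split=> w /=; [exact|move=> ? _].
  by rewrite (_ : mkset _ = setT)//; apply/seteqP; split.
by apply/seteqP; split=> w /= H t; [move=> _; exact: H|exact: H].
Qed.

Lemma measurable_history (A : set Omega) :
  measurable (A : set (history X n)) -> measurable A.
Proof.
have sub : <<s cylinders X n >> `<=` measurable.
  apply: smallest_sub; first exact: sigma_algebra_measurable.
  exact: measurable_cylinders.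
exact: sub.
Qed.

End cylinders_measurable.

(** * Joint laws of a hypothesis and of observations *)

Definition mfun_of d1 d2 (T1 : measurableType d1) (T2 : measurableType d2)
    (f : T1 -> T2) (mf : measurable_fun setT f) : {mfun T1 >-> T2} :=
  HB.pack f (isMeasurableFun.Build _ _ _ _ _ mf).

(** The measure structure of [pushforward] needs the measurability of [f], which
cannot be inferred from [f] alone. *)
Definition image_measure d1 d2 (T1 : measurableType d1) (T2 : measurableType d2)
  (R : realType) (m : {measure set T1 -> \bar R}) (f : T1 -> T2)
  (mf : measurable_fun setT f) : {measure set T2 -> \bar R}.
Proof. by refine (pushforward m f : {measure set T2 -> \bar R}); exact: mf. Defined.

(** The probability of the hypothesis [h] when that of hypothesis 0 is [p]; [p] is
the prior, or a belief. *)
Definition hyp_prob (R : realType) (p : R) (h : bool) := if h then 1 - p else p.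
Arguments hyp_prob {R} p h : simpl never.

Section joint_tools.
Context d (Omega : measurableType d) (R : realType).
Variables (law : bool -> probability Omega R) (p : R).
Hypothesis p01 : 0 <= p <= 1.

Lemma hyp_prob_ge0 h : 0 <= hyp_prob p h.
Proof. by case/andP: p01 => p0 p1; case: h; rewrite /hyp_prob// subr_ge0. Qed.

Lemma jointE A : joint law p A =
  (p%:E * law false (xsection A false) + (1 - p)%:E * law true (xsection A true))%E.
Proof.
rewrite /joint integral_bernoulli_prob//; last first.
  by case/andP: p01 => p0 p1; rewrite subr_ge0 p1 lerBlDr lerDl.
by rewrite addeC; congr (_%:E * _ + _)%E; exact: subKr.
Qed.

Lemma joint_sum (A : set (bool * Omega)) :
  joint law p A = (\sum_(h : bool) (hyp_prob p h)%:E * law h (xsection A h))%E.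
Proof.
by rewrite big_bool/= addeC; exact: jointE.
Qed.

Lemma joint_slice h (A : set Omega) :
  joint law p [set x | x.1 = h /\ A x.2] = ((hyp_prob p h)%:E * law h A)%E.
Proof.
have sec b : xsection [set x | x.1 = h /\ A x.2] b = if b == h then A else set0.
  by apply/seteqP; split=> w; rewrite /xsection/= inE/=;
    case: eqP => [->|bh] // => -[].
by rewrite jointE !sec; case: h {sec}; rewrite measure0 mule0 ?adde0 ?add0e.
Qed.

Lemma measurable_slice h (A : set Omega) : measurable A ->
  measurable [set x : bool * Omega | x.1 = h /\ A x.2].
Proof.
by move=> mA; rewrite (_ : mkset _ = [set h] `*` A)//; exact: measurableX.
Qed.

Lemma ge0_joint_integral (F : bool * Omega -> \bar R) :
  measurable_fun setT F -> (forall x, 0 <= F x)%E ->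
  (\int[joint law p]_x F x = p%:E * \int[law false]_w F (false, w) +
    (1 - p)%:E * \int[law true]_w F (true, w))%E.
Proof.
move=> mF F0.
have w0 h : 0 <= hyp_prob p h by exact: hyp_prob_ge0.
pose m h : {measure set (bool * Omega) -> \bar R} :=
  mscale (NngNum (w0 h)) (distribution (law h) (mfun_of (pair1_measurable h))).
rewrite (@eq_measure_integral _ _ _ _ (measure_add (m false) (m true))).
  rewrite ge0_integral_measure_add// !ge0_integral_mscale//.
  by rewrite !ge0_integral_distribution.
move=> A mA _; transitivity (m false A + m true A)%E; last first.
  by apply/esym; exact: measure_addE.
apply: etrans; first exact: jointE.
rewrite /m /= /mscale/= /distribution /pushforward.
by congr (_ * law _ _ + _ * law _ _)%E; apply/seteqP; split=> w;
  rewrite /xsection/= inE.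
Qed.

End joint_tools.

Section bayes.
Context d (Omega : measurableType d) (R : realType).
Variables (law : bool -> probability Omega R) (p : R).
Hypothesis p01 : 0 <= p <= 1.

(** * Bayes' rule *)

(** [b] is a version of P(H = 0 | X). *)
Definition is_posterior d' (S : measurableType d') (X : Omega -> S)
    (b : S -> R) : Prop :=
  [/\ measurable_fun setT b, forall s, 0 <= b s <= 1 &
    forall B, measurable B ->
      (\int[joint law p]_(x in [set x | B (X x.2)]) (b (X x.2))%:E)%E =
      joint law p [set x | x.1 = false /\ B (X x.2)]].

Definition marginal d' (S : measurableType d') (X : {mfun Omega >-> S}) :
    probability S R :=
  distribution (joint law p)
    (mfun_of (measurableT_comp (measurable_funPT X) measurable_snd)).

Lemma measurable_hyp_prob d' (S : measurableType d') (b : S -> R) h :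
  measurable_fun setT b -> measurable_fun setT (fun s => hyp_prob (b s) h).
Proof. by move=> mb; case: h => //; exact: measurable_funB. Qed.

Section one_observation.
Context d' (S : measurableType d') (X : {mfun Omega >-> S}).
Variable b : S -> R.
Hypothesis postb : is_posterior X b.

Lemma marginalE B : measurable B -> marginal X B =
  ((hyp_prob p false)%:E * distribution (law false) X B +
   (hyp_prob p true)%:E * distribution (law true) X B)%E.
Proof.
move=> mB; apply: etrans; first exact: jointE.
by congr (_ * law _ _ + _ * law _ _)%E; apply/seteqP; split=> w;
  rewrite /xsection/= inE.
Qed.

Lemma integral_marginal (G : S -> R) B :
  measurable_fun setT G -> (forall s, 0 <= G s) -> measurable B ->
  (\int[marginal X]_(s in B) (G s)%:E =
   \int[joint law p]_(x in [set x | B (X x.2)]) (G (X x.2))%:E)%E.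
Proof.
move=> mG G0 mB; rewrite /marginal /distribution/= ge0_integral_pushforward//=.
- exact: measurableT_comp.
- by apply/measurable_EFinP; exact: measurable_funTS.
- by move=> s _; rewrite lee_fin.
Qed.

(** In terms of densities: the conditional law of [X] given [h], scaled by the prior
probability of [h], has the posterior probability of [h] as its density with
respect to the marginal law of [X]. *)
Lemma posterior_hyp_prob h B : measurable B ->
  ((hyp_prob p h)%:E * distribution (law h) X B =
   \int[marginal X]_(s in B) (hyp_prob (b s) h)%:E)%E.
Proof.
case: postb => mb b01 bE mB.
have E0 : ((hyp_prob p false)%:E * distribution (law false) X B =
   \int[marginal X]_(s in B) (b s)%:E)%E.
  rewrite integral_marginal// => [|s]; last by case/andP: (b01 s).
  rewrite bE//; apply: esym.
  exact: (joint_slice law p01 false (X @^-1` B)).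
case: h => //.
have b1 s : 0 <= 1 - b s by rewrite subr_ge0; case/andP: (b01 s).
have : (\int[marginal X]_(s in B) (b s)%:E +
    \int[marginal X]_(s in B) (1 - b s)%:E = marginal X B)%E.
  rewrite -ge0_integralD//.
  - under eq_integral do rewrite -EFinD addrC subrK.
    by rewrite integral_cst// mul1e.
  - by move=> s _; rewrite lee_fin; case/andP: (b01 s).
  - by apply/measurable_EFinP; exact: measurable_funTS.
  - by move=> s _; rewrite lee_fin.
  - by apply/measurable_EFinP; apply: measurable_funTS; exact: measurable_funB.
(* For h = 1, subtract the identity for h = 0 from the total mass of [B]. *)
rewrite marginalE// -E0 => /(congr1 (fun z => z - (hyp_prob p false)%:E *
  distribution (law false) X B)%E).
have fin h : ((hyp_prob p h)%:E * distribution (law h) X B)%E \is a fin_num.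
  by rewrite fin_numM// fin_prob.
by rewrite addeAC subee ?fin// add0e addeAC subee ?fin// add0e => ->.
Qed.

Lemma ge0_integral_posterior h (G : S -> \bar R) :
  measurable_fun setT G -> (forall s, 0 <= G s)%E ->
  ((hyp_prob p h)%:E * \int[distribution (law h) X]_s G s =
   \int[marginal X]_s (G s * (hyp_prob (b s) h)%:E))%E.
Proof.
move=> mG G0; case: (postb) => mb b01 _.
rewrite -(ge0_integral_density (nu := mscale (NngNum (hyp_prob_ge0 p01 h))
  (distribution (law h) X)))//.
- by rewrite ge0_integral_mscale.
- exact: measurable_hyp_prob.
- by move=> s; exact: hyp_prob_ge0.
- by move=> A mA; rewrite -posterior_hyp_prob.
Qed.

End one_observation.

(** The posterior q f_0(y) / (q f_0(y) + (1 - q) f_1(y)) as a function of the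
belief q and of the observation y.  The quotient is written as a real power,
which is a measurable function of its base. *)
Definition bayes_update d' (T : measurableType d') (f : bool -> T -> R)
    (x : R * T) : R :=
  hyp_prob x.1 false * f false x.2 *
  (hyp_prob x.1 false * f false x.2 + hyp_prob x.1 true * f true x.2) `^ (-1).

Context d1 (S : measurableType d1) d2 (T : measurableType d2).
Variables (X : {mfun Omega >-> S}) (Y : {mfun Omega >-> T}).
Hypothesis indepXY : forall h B C, measurable B -> measurable C ->
  law h (X @^-1` B `&` Y @^-1` C) = (law h (X @^-1` B) * law h (Y @^-1` C))%E.
Hypothesis densY : has_densities law Y.

Let XY : {mfun Omega >-> (S * T)%type} :=
  mfun_of (measurable_fun_pair (measurable_funPT X) (measurable_funPT Y)).

(** Both posteriors have the same integrals over the events generated by (X, Y),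
which makes them almost surely equal.  For the update this is computed in the
product of the marginal law of [X] and of the reference measure of the densities:
the law of (X, Y) restricted to H = h has density [hyp_prob (b x) h * f h y] there,
and multiplying the update by the sum of these two densities gives back the first
one. *)
Lemma bayes_rule (b : S -> R) (b' : S * T -> R) :
  is_posterior X b -> is_posterior XY b' ->
  exists2 phi : R * T -> R, measurable_fun setT phi &
    exists N, [/\ measurable N, marginal XY N = 0%E &
      forall w, ~ N (XY w) -> b' (XY w) = phi (b (X w), Y w)].
Proof.
move=> postb postb'; case: (postb) => mb b01 _; case: (postb') => mb' b'01 b'E.
case: densY => mu [f fP].
have mf h : measurable_fun setT (f h) by case: (fP h).
have f0 h y : 0 <= f h y by case: (fP h).
have lawY h C : measurable C ->
    distribution (law h) Y C = (\int[mu]_(y in C) (f h y)%:E)%E.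
  by move=> mC; case: (fP h) => _ _; exact.
pose phi := bayes_update f.
have mphi : measurable_fun setT phi.
  have mw h : measurable_fun setT (fun x : R * T => hyp_prob x.1 h * f h x.2).
    apply: measurable_funM; first exact: measurable_hyp_prob.
    exact: measurableT_comp.
  apply: measurable_funM => //.
  apply: (@measurableT_comp _ _ _ _ _ _ (@powR R ^~ (-1))) => //.
  exact: measurable_funD.
exists phi => //.
pose psi (z : S * T) := phi (b z.1, z.2).
have mpsi : measurable_fun setT psi.
  apply: measurableT_comp => //; apply: measurable_fun_pair => //.
  exact: measurableT_comp.
have w0 h s : 0 <= hyp_prob (b s) h by exact: hyp_prob_ge0.
have den0 z : 0 <= hyp_prob (b z.1) false * f false z.2 +
                   hyp_prob (b z.1) true * f true z.2.
  by rewrite addr_ge0 ?mulr_ge0.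
have psi0 z : 0 <= psi z.
  by apply: mulr_ge0; [apply: mulr_ge0 => /=|exact: powR_ge0].
(* If the denominator vanishes, so does each of its two terms. *)
have psiE z : psi z * (hyp_prob (b z.1) false * f false z.2 +
    hyp_prob (b z.1) true * f true z.2) = hyp_prob (b z.1) false * f false z.2.
  rewrite /psi /phi /bayes_update /= powR_inv1 ?den0//.
  have [e0|n0] := eqVneq (hyp_prob (b z.1) false * f false z.2 +
    hyp_prob (b z.1) true * f true z.2) 0; last by rewrite mulfVK.
  rewrite e0 mulr0; apply/esym.
  by move/eqP: e0; rewrite paddr_eq0 ?mulr_ge0// => /andP[/eqP].
pose K h (F : S * T -> \bar R) z : \bar R :=
  (F z * (f h z.2 * hyp_prob (b z.1) h)%:E)%E.
have mK h F : measurable_fun setT F -> measurable_fun setT (K h F).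
  move=> mF; apply: emeasurable_funM => //; apply/measurable_EFinP.
  apply: measurable_funM; first exact: measurableT_comp.
  by apply: measurable_hyp_prob; exact: measurableT_comp.
have K0 h F z : (forall z, 0 <= F z)%E -> (0 <= K h F z)%E.
  by move=> F0; rewrite mule_ge0// lee_fin mulr_ge0.
(* Integration of [F (X, Y)] under H = h, by Tonelli and the two densities. *)
have condE h F : measurable_fun setT F -> (forall z, 0 <= F z)%E ->
  ((hyp_prob p h)%:E * \int[law h]_w F (XY w) =
   \int[marginal X]_s \int[mu]_y K h F (s, y))%E.
  move=> mF F0.
  rewrite -(ge0_integral_distribution XY)//.
  rewrite (@eq_measure_integral _ _ _ _
    (distribution (law h) X \x distribution (law h) Y)%E); last first.
    move=> A mA _; apply/esym; apply: product_measure_unique => //.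
    by move=> B C mB mC; exact: indepXY.
  rewrite fubini_tonelli1// (ge0_integral_posterior postb)//; last 2 first.
  - exact: measurable_fun_fubini_tonelli_F.
  - by move=> s; apply: integral_ge0.
  apply: eq_integral => s _; rewrite /fubini_F.
  have mFs : measurable_fun setT (fun y => F (s, y)).
    exact: measurable_fun_pair2.
  rewrite (ge0_integral_density (mu := mu) (mf h) (f0 h))//; last exact: lawY.
  rewrite -ge0_integralZr//.
  - by apply: eq_integral => y _; rewrite /K/= EFinM muleA.
  - by apply: emeasurable_funM => //; exact/measurable_EFinP.
  - by move=> y _; rewrite mule_ge0 ?lee_fin.
  - by rewrite lee_fin.
have mXY2 : measurable_fun setT (XY \o snd : bool * Omega -> S * T).
  exact: measurableT_comp.
have psi_post D : measurable D ->
    (\int[joint law p]_(x in [set x | D (XY x.2)]) (psi (XY x.2))%:E =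
     joint law p [set x | x.1 = false /\ D (XY x.2)])%E.
  move=> mD; pose I z : \bar R := (\1_D z)%:E.
  pose F z : \bar R := (I z * (psi z)%:E)%E.
  have mI : measurable_fun setT I by apply/measurable_EFinP; exact: measurable_indic.
  have I0 z : (0 <= I z)%E by rewrite lee_fin.
  have mF : measurable_fun setT F.
    by apply: emeasurable_funM => //; exact/measurable_EFinP.
  have F0 z : (0 <= F z)%E by rewrite mule_ge0 ?lee_fin.
  rewrite (joint_slice law p01 false (XY @^-1` D)).
  transitivity ((hyp_prob p false)%:E * \int[law false]_w I (XY w))%E; last first.
    congr (_ * _)%E; transitivity (\int[law false]_w (\1_(XY @^-1` D) w)%:E)%E => //.
    by rewrite integral_indic ?setIT//; exact: measurable_preimageT.
  transitivity (\int[joint law p]_x F (XY x.2))%E.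
    rewrite integral_mkcond; apply: eq_integral => x _.
    by rewrite epatch_indic muleC.
  rewrite ge0_joint_integral//=; last exact: (measurableT_comp mF mXY2).
  rewrite (condE false)// (condE true)// (condE false I)//.
  have mKF h G : measurable_fun setT G -> (forall z, 0 <= G z)%E ->
    measurable_fun setT (fun s => \int[mu]_y K h G (s, y))%E.
    move=> mG G0; have KG0 z : (0 <= K h G z)%E by exact: K0.
    exact: (@measurable_fun_fubini_tonelli_F _ _ _ _ _ mu _ (mK h G mG) KG0).
  rewrite -ge0_integralD//; last 4 first.
  - by move=> s _; apply: integral_ge0 => y _; exact: K0.
  - exact: mKF.
  - by move=> s _; apply: integral_ge0 => y _; exact: K0.
  - exact: mKF.
  apply: eq_integral => s _; rewrite -ge0_integralD//; last 4 first.
  - by move=> y _; exact: K0.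
  - by apply: measurable_fun_pair2; exact: mK.
  - by move=> y _; exact: K0.
  - by apply: measurable_fun_pair2; exact: mK.
  apply: eq_integral => y _; rewrite /K /F/= -!EFinM -EFinD; congr (_%:E).
  rewrite -mulrDr -mulrA [f false y * _]mulrC [f true y * _]mulrC.
  by rewrite (psiE (s, y)).
have [N [mN N0 sN]] : ae_eq (marginal XY) setT (EFin \o b') (EFin \o psi).
  apply: integral_ae_eq => //.
  - apply: measurable_bounded_integrable => //.
      by rewrite ltey_eq fin_prob.
    exists 1; split; first exact: num_real.
    move=> M M1 z _ /=; rewrite ger0_norm; last by case/andP: (b'01 z).
    by rewrite (le_trans _ (ltW M1))//; case/andP: (b'01 z).
  - exact/measurable_EFinP.
  - move=> D _ mD; rewrite !integral_marginal//; last first.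
      by move=> z; case/andP: (b'01 z).
    by rewrite b'E// psi_post.
exists N; split => // x Nx; apply: contrapT => neq; apply: Nx; apply: sN => /=.
by move=> H; apply: neq; have [] := H I.
Qed.

End bayes.

(** * Conditional independence in the model *)

Section model_facts.
Context (R : realType) d d1 d2 (Omega : measurableType d)
  (Y1 : measurableType d1) (Y2 : measurableType d2).
Variable M : model R Omega Y1 Y2.
Local Notation P := (joint (law M) (prior M)).
Local Notation past t := (history (obs1 M) t).
Local Notation data2 := (history (obs2 M) (T2 M)).

Lemma past_measurable t (A : set Omega) : (t <= T1 M)%N ->
  measurable (A : set (past t)) -> measurable A.
Proof.
move=> tT; apply: measurable_history => s /andP[s1 st].
by apply: measurable_obs1; rewrite s1 (leq_trans st).
Qed.

Lemma data2_measurable (A : set Omega) :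
  measurable (A : set data2) -> measurable A.
Proof. by apply: measurable_history => s sT; exact: measurable_obs2. Qed.

Lemma prod_law_setT h (m n : nat) (a : nat -> set Omega) :
  (forall s, (m <= s < n)%N -> a s = setT) ->
  (\prod_(m <= s < n) law M h (a s) = 1)%E.
Proof.
by move=> aT; rewrite big_nat big1// => s /aT ->; exact: probability_setT.
Qed.

(** Imposing no constraint on the observations of one observer leaves the product
rule for the other one; likewise for [law_cylinder2]. *)
Lemma law_cylinder1 h (A : nat -> set Y1) : (forall t, measurable (A t)) ->
  law M h [set w | forall t, (1 <= t <= T1 M)%N -> A t (obs1 M t w)] =
  (\prod_(1 <= t < (T1 M).+1) law M h (obs1 M t @^-1` A t))%E.
Proof.
move=> mA; have := @cond_independent_obs _ _ _ _ _ _ _ M h A (fun=> setT) mA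
  (fun=> measurableT).
rewrite [X in (_ * X)%E]prod_law_setT// mule1 => <-.
by congr (law M h _); apply/seteqP; split=> w /= => [H|[]].
Qed.

Lemma law_cylinder2 h (B : nat -> set Y2) : (forall t, measurable (B t)) ->
  law M h [set w | forall t, (1 <= t <= T2 M)%N -> B t (obs2 M t w)] =
  (\prod_(1 <= t < (T2 M).+1) law M h (obs2 M t @^-1` B t))%E.
Proof.
move=> mB; have := @cond_independent_obs _ _ _ _ _ _ _ M h (fun=> setT) B
  (fun=> measurableT) mB.
rewrite [X in (X * _)%E]prod_law_setT// mul1e => <-.
by congr (law M h _); apply/seteqP; split=> w /= => [H|[]].
Qed.

(** The product rule holds for cylinders and extends to the generated
sigma-algebras in one argument at a time. *)
Lemma indep_past_data2 h (A B : set Omega) :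
  measurable (A : set (past (T1 M))) -> measurable (B : set data2) ->
  law M h (A `&` B) = (law M h A * law M h B)%E.
Proof.
have mc1 := @measurable_cylinders _ _ _ _ (obs1 M) (T1 M)
  (@measurable_obs1 _ _ _ _ _ _ _ M).
have mc2 := @measurable_cylinders _ _ _ _ (obs2 M) (T2 M)
  (@measurable_obs2 _ _ _ _ _ _ _ M).
have cc C D : cylinders (obs1 M) (T1 M) C -> cylinders (obs2 M) (T2 M) D ->
    law M h (C `&` D) = (law M h C * law M h D)%E.
  move=> [E mE ->] [F mF ->].
  rewrite law_cylinder1// law_cylinder2//.
  exact: cond_independent_obs.
move=> mA mB.
apply: (indep_g_sigma (G := cylinders (obs1 M) (T1 M))) => //.
- exact: cylindersI.
- exact: cylindersT.
- exact: data2_measurable.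
move=> C GC; rewrite setIC muleC.
apply: (indep_g_sigma (G := cylinders (obs2 M) (T2 M))) => //.
- exact: cylindersI.
- exact: cylindersT.
- exact: mc1.
by move=> D GD; rewrite setIC muleC; exact: cc.
Qed.

(** A cylinder in the first [t] observations and an event of the next one form a
single cylinder in all the observations, whose factors after time [t.+1] are 1. *)
Lemma indep_past_next h t (A : set Omega) (C : set Y1) : (t < T1 M)%N ->
  measurable (A : set (past t)) -> measurable C ->
  law M h (A `&` obs1 M t.+1 @^-1` C) =
  (law M h A * law M h (obs1 M t.+1 @^-1` C))%E.
Proof.
move=> tT mA mC.
have mobs s : (1 <= s <= t)%N -> measurable_fun setT (obs1 M s).
  by move=> /andP[s1 st]; apply: measurable_obs1; rewrite s1 (leq_trans st (ltnW tT)).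
have law_pair (E : nat -> set Y1) D : (forall s, measurable (E s)) -> measurable D ->
  law M h ([set w | forall s, (1 <= s <= t)%N -> E s (obs1 M s w)] `&`
           obs1 M t.+1 @^-1` D) =
  ((\prod_(1 <= s < t.+1) law M h (obs1 M s @^-1` E s)) *
    law M h (obs1 M t.+1 @^-1` D))%E.
  move=> mE mD.
  pose F s := if (s <= t)%N then E s else if s == t.+1 then D else setT.
  have mF s : measurable (F s) by rewrite /F; case: ifP => // _; case: ifP.
  transitivity (law M h [set w | forall s, (1 <= s <= T1 M)%N -> F s (obs1 M s w)]).
    congr (law M h _); apply/seteqP; split=> w /=.
      move=> [H Hn] s /andP[s1 sT]; rewrite /F; case: ifPn => [st|_].
        by apply: H; rewrite s1.
      by case: eqP => // ->.
    move=> H; split=> [s /andP[s1 st]|].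
      by have := H s; rewrite /F st s1 (leq_trans st (ltnW tT)); exact.
    by have := H t.+1; rewrite /F ltnn eqxx tT; exact.
  rewrite law_cylinder1// (big_cat_nat (n := t.+1))//=; last exact: ltnW.
  congr (_ * _)%E.
    by rewrite !big_nat; apply: eq_bigr => s /andP[_]; rewrite ltnS /F => ->.
  rewrite big_ltn// prod_law_setT ?mule1/=; last first.
    move=> s /andP[ts _]; rewrite /F leqNgt (ltn_trans _ ts)//= gtn_eqF//.
  by rewrite /F ltnn eqxx.
apply: (indep_g_sigma (G := cylinders (obs1 M) t)) => //.
- exact: cylindersI.
- exact: measurable_cylinders.
- exact: cylindersT.
- by apply: measurable_preimageT => //; apply: measurable_obs1.
move=> _ [E mE ->]; rewrite law_pair//; congr (_ * _)%E.
have := law_pair E setT mE measurableT.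
by rewrite preimage_setT setIT probability_setT mule1.
Qed.

End model_facts.

(** * Information states *)

Section information_states.
Context (R : realType) d d1 d2 (Omega : measurableType d)
  (Y1 : measurableType d1) (Y2 : measurableType d2).
Variable M : model R Omega Y1 Y2.
Local Notation P := (joint (law M) (prior M)).
Local Notation past t := (history (obs1 M) t).
Variable pi : forall t, t.-tuple Y1 -> R.
Hypothesis hpi : is_belief1 M pi.

(** The message as a function of the belief alone, uniformly in time. *)
Definition rule (g : policy1 R) t (q : R) : option bool :=
  if (t < T1 M)%N then threshold_message (thr g t) q else Some (q <= last_thr g).

Lemma measurable_rule g t z : measurable [set q | rule g t q = z].
Proof.
have mint (a b : R) : measurable [set q : R | (a <= q <= b)%R].
  suff -> : [set q : R | (a <= q <= b)%R] = `[a, b]%classic by exact: measurable_itv.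
  by apply/seteqP; split=> q /=; rewrite in_itv.
rewrite /rule; case: (t < T1 M)%N; last first.
  have mc b : measurable [set q : R | (q <= last_thr g) = b].
    have mle : measurable [set q : R | q <= last_thr g].
      suff -> : [set q : R | q <= last_thr g] = `]-oo, last_thr g]%classic.
        exact: measurable_itv.
      by apply/seteqP; split=> q /=; rewrite in_itv.
    case: b => //.
    rewrite (_ : mkset _ = ~` [set q : R | q <= last_thr g]).
      exact: measurableC.
    by apply/seteqP; split=> q /=; [move=> ->|move/negP/negbTE].
  case: z => [b|]; last by rewrite (_ : mkset _ = set0)//; apply/seteqP; split.
  rewrite (_ : mkset _ = [set q : R | (q <= last_thr g) = b])//.
  by apply/seteqP; split=> q /=; [move=> [] | move=> ->].
set I1 := [set q : R | alpha (thr g t) <= q <= beta (thr g t)].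
set I0 := [set q : R | delta (thr g t) <= q <= theta (thr g t)].
have mI1 : measurable I1 by exact: mint.
have mI0 : measurable I0 by exact: mint.
rewrite (_ : mkset _ = match z with
  | Some true => I1 | Some false => I0 `\` I1 | None => ~` I1 `&` ~` I0 end); last first.
  rewrite /threshold_message; apply/seteqP; split => q /=.
    case: ifPn => [q1 <- //|/negP q1]; case: ifPn => [q0 <- //|/negP q0 <- //].
  case: z => [[]|].
  - by rewrite /I1 /= => ->.
  - by move=> [] q0 /negP/negbTE; rewrite /I0/= in q0 *; rewrite q0 => ->.
  - by move=> [] /negP/negbTE -> /negP/negbTE ->.
case: z => [[]|]//; first exact: measurableD.
by apply: measurableI; exact: measurableC.
Qed.

Lemma measurable_belief s t : (1 <= s <= t)%N -> (t <= T1 M)%N ->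
  measurable_fun setT ((fun w => pi (hist1 M s w)) : past t -> R).
Proof.
move=> /andP[s1 st] tT; apply: (measurableT_comp (f := @pi s)).
  by case: (@hpi s); rewrite ?s1 ?(leq_trans st).
exact: measurable_history_tuple.
Qed.

Lemma measurable_belief_Omega t : (1 <= t <= T1 M)%N ->
  measurable_fun setT (fun w : Omega => pi (hist1 M t w)).
Proof.
move=> /andP[t1 tT] _ B mB; rewrite setTI.
apply: (@past_measurable _ _ _ _ _ _ _ M t) => //.
rewrite -[X in measurable X]setTI.
by apply: measurable_belief => //; rewrite t1 leqnn.
Qed.

Definition rule_event g t z : set Omega := [set w | rule g t (pi (hist1 M t w)) = z].
(** Messages depend on the observations only, and not on the hypothesis; working
with events of the space of observations makes them measurable with respect to the
past. *)
Definition silent g t : set Omega :=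
  [set w | forall s, (1 <= s <= t)%N -> rule_event g s None w].

Lemma measurable_rule_event g s t z : (1 <= s <= t)%N -> (t <= T1 M)%N ->
  measurable (rule_event g s z : set (past t)).
Proof.
move=> st tT; have := measurable_belief st tT measurableT (measurable_rule g s z).
by rewrite setTI.
Qed.

Lemma silent0 g : silent g 0 = setT.
Proof. by apply/seteqP; split=> // w _ s /= /andP[]; case: s. Qed.

Lemma silentS g t : silent g t.+1 = silent g t `&` rule_event g t.+1 None.
Proof.
apply/seteqP; split=> w /=.
  move=> H; split=> [s /andP[s1 st]|]; apply: H; first by rewrite s1 ltnW.
  by rewrite ltnSn.
move=> [H Ht] s /andP[s1]; rewrite leq_eqVlt => /orP[/eqP->//|].
by rewrite ltnS => st; apply: H; rewrite s1.
Qed.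

Lemma measurable_silent g s t : (s <= t)%N -> (t <= T1 M)%N ->
  measurable (silent g s : set (past t)).
Proof.
elim: s => [|s IH] st tT; first by rewrite silent0.
rewrite silentS; apply: measurableI; first by apply: IH => //; exact: ltnW.
exact: measurable_rule_event.
Qed.

Definition lift_event (A : set Omega) : set (bool * Omega) := [set x | A x.2].

Lemma measurable_lift (A : set Omega) : measurable A -> measurable (lift_event A).
Proof.
by move=> mA; apply: (@measurable_preimageT _ _ _ _ (@snd bool Omega)).
Qed.

Lemma past_lift t (A : set Omega) : (t <= T1 M)%N ->
  measurable (A : set (past t)) -> measurable (lift_event A).
Proof. by move=> tT mA; apply: measurable_lift; exact: past_measurable mA. Qed.

Definition belief_event t (A : set (bool * R)) : set (bool * Omega) :=
  [set x | A (x.1, belief1 M pi t x)].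

Lemma measurable_belief_event t A : (1 <= t <= T1 M)%N -> measurable A ->
  measurable (belief_event t A).
Proof.
move=> tT mA.
have mb := measurable_belief_Omega tT.
apply: (@measurable_preimageT _ _ _ _
  (fun x : bool * Omega => (x.1, pi (hist1 M t x.2)))) => //.
by apply: measurable_fun_pair => //; exact: (measurableT_comp mb measurable_snd).
Qed.

Lemma cond_lawE E t A : measurable A ->
  cond_law M pi E t A = fine (P (E `&` belief_event t A)) / fine (P E).
Proof. by move=> mA; rewrite /cond_law asboolT. Qed.

Lemma fine_P0 E : measurable E -> ~~ (0 < P E)%E -> fine (P E) = 0.
Proof. by move=> mE; rewrite lt0e measure_ge0 andbT negbK => /eqP ->. Qed.

(** Conditioning a joint law on the belief being in [B], written with its values
only, as the argument ranges over arbitrary set functions. *)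
Definition filtered_law (l : joint_law_type R) (B : set R) : joint_law_type R :=
  fun A => if `[< measurable A >] then
    l (A `&` [set x | B x.2]) / l [set x | B x.2] else 0.

(** The normalization by P(E) cancels; if it is zero then every quotient is, in
view of the convention for division by zero. *)
Lemma cond_law_filter E t B : (1 <= t <= T1 M)%N -> measurable E -> measurable B ->
  cond_law M pi (E `&` [set x | B (belief1 M pi t x)]) t =
  filtered_law (cond_law M pi E t) B.
Proof.
move=> tT mE mB; have mB2 : measurable [set x : bool * R | B x.2].
  exact: (@measurable_preimageT _ _ _ _ (@snd bool R)).
apply/funext => A; rewrite {1}/cond_law /filtered_law.
case: ifPn => // /asboolP mA; rewrite !cond_lawE//; last exact: measurableI.
have -> : E `&` [set x | B (belief1 M pi t x)] =
    E `&` belief_event t [set x | B x.2] by [].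
have -> : E `&` belief_event t [set x | B x.2] `&` [set x | A (x.1, belief1 M pi t x)]
  = E `&` belief_event t (A `&` [set x | B x.2]).
  by apply/seteqP; split=> x; rewrite /belief_event/=; tauto.
have [E0|E0] := boolP (0 < P E)%E.
  have c0 : fine (P E) != 0 by rewrite gt_eqF// fine_gt0// E0/= ltey_eq fin_prob.
  by rewrite invf_div mulrA mulfVK.
have z0 A' : measurable A' -> fine (P (E `&` belief_event t A')) = 0.
  move=> mA'; apply/eqP; rewrite eq_le fine_ge0// andbT -(fine_P0 mE E0).
  have mEb := measurableI _ _ mE (measurable_belief_event tT mA').
  by rewrite fine_le ?fin_prob// le_measure ?inE.
by rewrite !z0 ?mul0r//; exact: measurableI.
Qed.

Lemma blanks_silent g t : blanks M pi g t = lift_event (silent g t).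
Proof. by []. Qed.

Lemma measurable_blanks g t : (t <= T1 M)%N -> measurable (blanks M pi g t).
Proof. by move=> tT; exact: (past_lift tT (measurable_silent g (leqnn t) tT)). Qed.

Lemma eta_lawE g t z : (1 <= t <= T1 M)%N ->
  eta_law M pi g t z = filtered_law (xi_law M pi g t) [set q | rule g t q = z].
Proof.
move=> /andP[t1 tT]; rewrite /eta_law.
rewrite [X in _ `&` X](_ : _ =
  [set x | [set q | rule g t q = z] (belief1 M pi t x)])//.
rewrite cond_law_filter// ?t1//; last exact: measurable_rule.
by apply: measurable_blanks; rewrite (leq_trans (leq_pred _)).
Qed.

Lemma xi_law1 g : xi_law M pi g 1 = cond_law M pi setT 1.
Proof. by rewrite /xi_law/= blanks_silent silent0. Qed.

Lemma eta_law_eq g g' t z : (1 <= t < T1 M)%N ->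
  xi_law M pi g t = xi_law M pi g' t -> thr g t = thr g' t ->
  eta_law M pi g t z = eta_law M pi g' t z.
Proof.
move=> /andP[t1 tT] xiE thrE.
have t_bounds : (1 <= t <= T1 M)%N by rewrite t1 ltnW.
rewrite (eta_lawE g z t_bounds) (eta_lawE g' z t_bounds) xiE.
by rewrite /rule tT thrE.
Qed.

Lemma blanks_same_past g g' t : (t <= T1 M)%N -> same_past g g' t ->
  blanks M pi g t.-1 = blanks M pi g' t.-1.
Proof.
move=> tT gg'; apply/seteqP; split=> x /= H s /andP[s1 st];
  have := H s; rewrite s1 st => /(_ isT);
  have st' : (s < t)%N by (case: t {tT gg' H} st => [|t]//=; case: s s1).
  by rewrite /message (leq_trans st' tT) (gg' s)// s1.
by rewrite /message (leq_trans st' tT) (gg' s)// s1.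
Qed.

Lemma xi_law_same_past g g' t : (1 <= t <= T1 M)%N -> same_past g g' t ->
  xi_law M pi g t = xi_law M pi g' t.
Proof.
by move=> /andP[_ tT] gg'; rewrite /xi_law (blanks_same_past tT gg').
Qed.

Lemma blanksS g t : (1 <= t)%N ->
  blanks M pi g t = blanks M pi g t.-1 `&` [set x | message M pi g t x = None].
Proof. by case: t => // t _; rewrite blanks_silent silentS. Qed.

End information_states.

(** * Evolution of the belief and of the information state *)

Section belief_update.
Context (R : realType) d d1 d2 (Omega : measurableType d)
  (Y1 : measurableType d1) (Y2 : measurableType d2).
Variable M : model R Omega Y1 Y2.
Local Notation P := (joint (law M) (prior M)).
Local Notation past t := (history (obs1 M) t).
Variable pi : forall t, t.-tuple Y1 -> R.
Hypothesis hpi : is_belief1 M pi.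

(** The belief at time [t.+1] is a function of a tuple of [t.+1] observations,
whereas Bayes' rule speaks of the pair of the past and of the new observation. *)
Definition split_last t (v : t.+1.-tuple Y1) : t.-tuple Y1 * Y1 :=
  ([tuple tnth v (widen_ord (leqnSn t) i) | i < t], tnth v ord_max).

Definition append_last t (z : t.-tuple Y1 * Y1) : t.+1.-tuple Y1 :=
  [tuple of rcons z.1 z.2].

Lemma measurable_split_last t : measurable_fun setT (@split_last t).
Proof.
apply: measurable_fun_pair; last exact: measurable_tnth.
apply/measurable_fun_tnthP => i.
rewrite (_ : _ \o _ = @tnth t.+1 Y1 ^~ (widen_ord (leqnSn t) i)).
  exact: measurable_tnth.
by apply/funext => v /=; rewrite tnth_mktuple.
Qed.

Lemma measurable_append_last t : measurable_fun setT (@append_last t).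
Proof.
apply/measurable_fun_tnthP => i; have [it|it] := ltnP i t.
  rewrite (_ : _ \o _ = fun z => tnth z.1 (Ordinal it)).
    exact: (measurableT_comp (measurable_tnth _) measurable_fst).
  apply/funext => z /=; rewrite !(tnth_nth z.2)/= nth_rcons size_tuple it.
  by [].
rewrite (_ : _ \o _ = snd)//.
apply/funext => z /=; rewrite (tnth_nth z.2)/= nth_rcons size_tuple ltnNge it/=.
by rewrite eqn_leq it -ltnS ltn_ord.
Qed.

Lemma hist1_append t w : hist1 M t.+1 w = append_last (hist1 M t w, obs1 M t.+1 w).
Proof.
apply: eq_from_tnth => i; rewrite tnth_mktuple.
rewrite (tnth_nth (obs1 M t.+1 w))/= nth_rcons size_map size_enum_ord.
have [it|it] := ltnP i t.
  rewrite (nth_map (Ordinal it)) ?size_enum_ord//.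
  by rewrite nth_enum_ord.
have /eqP -> : nat_of_ord i == t by rewrite eqn_leq it -ltnS ltn_ord.
by rewrite eqxx.
Qed.

Lemma split_append t z : split_last (@append_last t z) = z.
Proof.
case: z => v y; congr (_, _).
  apply: eq_from_tnth => i; rewrite tnth_mktuple !(tnth_nth y)/= nth_rcons.
  by rewrite size_tuple ltn_ord.
by rewrite (tnth_nth y)/= nth_rcons size_tuple ltnn eqxx.
Qed.

Section one_step.
Variable t : nat.
Hypothesis t_bounds : (1 <= t < T1 M)%N.

Let tT : (t < T1 M)%N. Proof. by case/andP: t_bounds. Qed.

Lemma measurable_hist1 : measurable_fun setT (hist1 M t).
Proof.
move=> _ B mB; rewrite setTI.
apply: (@past_measurable _ _ _ _ _ _ _ M t); first exact: ltnW.
have := measurable_history_tuple (X := obs1 M) (leqnn t) measurableT mB.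
by rewrite setTI.
Qed.

Lemma measurable_obs_next : measurable_fun setT (obs1 M t.+1).
Proof. exact: measurable_obs1. Qed.

Let X : {mfun Omega >-> t.-tuple Y1} := mfun_of measurable_hist1.
Let Y : {mfun Omega >-> Y1} := mfun_of measurable_obs_next.
Let XY : {mfun Omega >-> (t.-tuple Y1 * Y1)%type} :=
  mfun_of (measurable_fun_pair (measurable_funPT X) (measurable_funPT Y)).

Lemma posterior_now : is_posterior (law M) (prior M) X (@pi t).
Proof. by have [] := hpi (t := t); [case/andP: t_bounds => -> /ltnW|]. Qed.

Lemma posterior_next : is_posterior (law M) (prior M) XY (@pi t.+1 \o @append_last t).
Proof.
have [mp p01 pE] : [/\ measurable_fun setT (@pi t.+1),
  forall y, 0 <= @pi t.+1 y <= 1 & _] := hpi (t := t.+1) tT.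
split=> [|z|B mB]; [|exact: p01|].
  by apply: measurableT_comp => //; exact: measurable_append_last.
have XYE w : XY w = split_last (hist1 M t.+1 w) by rewrite hist1_append split_append.
have bE w : (@pi t.+1 \o @append_last t) (XY w) = pi (hist1 M t.+1 w).
  by rewrite hist1_append.
under eq_integral do rewrite bE.
rewrite (_ : [set x | B (XY x.2)] = [set x | (@split_last t @^-1` B) (hist1 M t.+1 x.2)]).
  rewrite pE//; last first.
    by apply: measurable_preimageT => //; exact: measurable_split_last.
  congr (joint _ _ _); apply/funext => x.
  exact: (congr1 (fun z => x.1 = false /\ B z) (esym (XYE x.2))).
by apply/funext => x; exact: (congr1 B (XYE x.2)).
Qed.

(** The update is the same for all policies of O1, as it refers to the observations
only; this is what makes the next information state independent of the policy. *)
Lemma belief_update : exists2 phi : R * Y1 -> R, measurable_fun setT phi &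
  exists N, [/\ measurable N, P (lift_event N) = 0%E &
    forall w, ~ N w -> pi (hist1 M t.+1 w) = phi (pi (hist1 M t w), obs1 M t.+1 w)].
Proof.
have indep h B C : measurable B -> measurable C ->
  law M h (X @^-1` B `&` Y @^-1` C) = (law M h (X @^-1` B) * law M h (Y @^-1` C))%E.
  move=> mB mC; apply: (indep_past_next h tT) => //.
  have := measurable_history_tuple (X := obs1 M) (leqnn t) measurableT mB.
  by rewrite setTI.
have dens : has_densities (law M) Y by exact: densities_obs1.
have [phi mphi [N [mN N0 NE]]] :=
  bayes_rule (prior01 M) indep dens posterior_now posterior_next.
exists phi => //; exists (XY @^-1` N); split=> [||w /NE <-].
- by apply: measurable_preimageT.
- exact: N0.
- by rewrite /= -hist1_append.
Qed.

End one_step.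
End belief_update.

Section next_information_state.
Context (R : realType) d d1 d2 (Omega : measurableType d)
  (Y1 : measurableType d1) (Y2 : measurableType d2).
Variable M : model R Omega Y1 Y2.
Local Notation P := (joint (law M) (prior M)).
Local Notation past t := (history (obs1 M) t).
Variable pi : forall t, t.-tuple Y1 -> R.
Hypothesis hpi : is_belief1 M pi.
Variable t : nat.
Hypothesis t_bounds : (1 <= t < T1 M)%N.

Let tT : (t < T1 M)%N. Proof. by case/andP: t_bounds. Qed.
Let tT' : (1 <= t <= T1 M)%N. Proof. by case/andP: t_bounds => -> /ltnW. Qed.

Definition state_and_obs (x : bool * Omega) : bool * R * Y1 :=
  ((x.1, belief1 M pi t x), obs1 M t.+1 x.2).

Lemma measurable_state_and_obs : measurable_fun setT state_and_obs.
Proof.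
have mb := measurable_belief_Omega hpi tT'.
apply: measurable_fun_pair.
  apply: measurable_fun_pair => //.
  exact: (measurableT_comp mb measurable_snd).
apply: (measurableT_comp _ measurable_snd).
exact: measurable_obs1.
Qed.

(** Given H = h, the new observation is independent of [E] and of the belief, so
that the conditional law of (H, belief, new observation) on rectangles is expressed
by the conditional law of (H, belief) and by the law of the new observation given
[h]. *)
Lemma cond_next_rectangle (E : set Omega) (A : set (bool * R)) (C : set Y1) :
  measurable (E : set (past t)) -> measurable A -> measurable C ->
  ((fine (P (lift_event E)))^-1%:E *
    P (lift_event E `&` state_and_obs @^-1` (A `*` C)) =
   \sum_(h : bool) (cond_law M pi (lift_event E) t (A `&` [set z | z.1 = h]))%:E *
     law M h (obs1 M t.+1 @^-1` C))%E.
Proof.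
move=> mE mA mC.
have mlE : measurable (lift_event E) by apply: (past_lift (ltnW tT) mE).
have mh h : measurable [set z : bool * R | z.1 = h].
  exact: (@measurable_preimageT _ _ _ _ (@fst bool R) [set h]).
pose B h : set Omega := [set w | A (h, pi (hist1 M t w))].
have mB h : measurable (B h : set (past t)).
  have mp : measurable_fun setT ((fun w => (h, pi (hist1 M t w))) : past t -> bool * R).
    apply: measurable_fun_pair => //; apply: measurable_belief => //.
      by case/andP: t_bounds => ->/=.
    exact: ltnW.
  by have := mp measurableT A mA; rewrite setTI.
have slice h : P (lift_event E `&` belief_event M pi t (A `&` [set z | z.1 = h])) =
    ((hyp_prob (prior M) h)%:E * law M h (E `&` B h))%E.
  rewrite -(joint_slice (law M) (prior01 M)); congr (joint _ _ _).
  apply/seteqP; split=> -[h' w]; rewrite /B/lift_event/belief_event/=.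
    by move=> [? []] + h'h; rewrite h'h.
  by move=> [-> [? ?]].
rewrite [X in (_ * X)%E = _](joint_sum _ (prior01 M)) ge0_sume_distrr; last first.
  by move=> h _; rewrite mule_ge0// lee_fin hyp_prob_ge0// prior01.
apply: eq_bigr => h _; rewrite cond_lawE//; last exact: measurableI.
rewrite slice mulrC EFinM fineK; last first.
  by rewrite -slice fin_prob//; apply: measurableI => //;
    apply: measurable_belief_event => //; exact: measurableI.
rewrite -!muleA; congr (_ * (_ * _))%E.
rewrite -indep_past_next//; last exact: measurableI.
congr (law M h _); apply/seteqP; split=> w; rewrite /xsection/= inE/=.
  by move=> [? [? ?]].
by move=> [[? ?] ?].
Qed.

(** Both sides are finite measures in [D], equal on rectangles. *)
Lemma cond_next_eq (E E' : set Omega) D :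
  measurable (E : set (past t)) -> measurable (E' : set (past t)) ->
  cond_law M pi (lift_event E) t = cond_law M pi (lift_event E') t ->
  measurable D ->
  ((fine (P (lift_event E)))^-1%:E *
    P (lift_event E `&` state_and_obs @^-1` D) =
   (fine (P (lift_event E')))^-1%:E *
    P (lift_event E' `&` state_and_obs @^-1` D))%E.
Proof.
move=> mE mE' EE' mD.
have mlE : measurable (lift_event E) by apply: (past_lift (ltnW tT) mE).
have mlE' : measurable (lift_event E') by apply: (past_lift (ltnW tT) mE').
have inv0 A : 0 <= (fine (P A))^-1 by rewrite invr_ge0 fine_ge0.
pose m A (mA : measurable A) : {measure set (bool * R * Y1) -> \bar R} :=
  mscale (NngNum (inv0 A)) (image_measure (mrestr P mA) measurable_state_and_obs).
have mEq A (mA : measurable A) F : m A mA F =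
  ((fine (P A))^-1%:E * P (A `&` state_and_obs @^-1` F))%E.
  by rewrite /m/= /mscale/= /image_measure/= /pushforward /mrestr setIC.
rewrite -(mEq _ mlE) -(mEq _ mlE').
apply: (measure_unique [set A `*` B | A in measurable & B in measurable]
  (fun=> setT)) => //.
- by rewrite measurable_prod_measurableType.
- move=> _ _ [A1 mA1 [B1 mB1 <-]] [A2 mA2 [B2 mB2 <-]]; rewrite -setXI.
  by exists (A1 `&` A2); [exact: measurableI|exists (B1 `&` B2) => //; exact: measurableI].
- by move=> _; exists setT => //; exists setT => //; rewrite setXTT.
- by rewrite bigcup_const.
- move=> _ [A mA [B mB <-]]; apply: etrans; first exact: mEq.
  apply: etrans; last by apply: esym; exact: mEq.
  by rewrite !cond_next_rectangle// EE'.
- move=> _; apply: (@le_lt_trans _ _ ((fine (P (lift_event E)))^-1%:E * 1)%E).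
    apply: (le_trans (y := ((fine (P (lift_event E)))^-1%:E *
      P (lift_event E `&` state_and_obs @^-1` setT))%E)).
      by rewrite (mEq _ mlE setT).
    rewrite lee_wpmul2l ?lee_fin//; apply: probability_le1.
    by rewrite setIT.
  by rewrite mule1 ltry.
Qed.

(** Up to a negligible event, the next belief being in [A] is an event in terms of
the hypothesis, the current belief and the new observation, to which
[cond_next_eq] applies. *)
Lemma xi_law_eta g g' :
  eta_law M pi g t None = eta_law M pi g' t None ->
  xi_law M pi g t.+1 = xi_law M pi g' t.+1.
Proof.
have t1 : (0 < t)%N by case/andP: t_bounds.
rewrite /eta_law -!(blanksS _ _ _ t1) /xi_law/= !blanks_silent.
set E := silent M pi g t; set E' := silent M pi g' t => EE'.
have mE : measurable (E : set (past t)) by apply: measurable_silent => //; exact: ltnW.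
have mE' : measurable (E' : set (past t)) by apply: measurable_silent => //; exact: ltnW.
have mlE : measurable (lift_event E) by apply: (past_lift (ltnW tT) mE).
have mlE' : measurable (lift_event E') by apply: (past_lift (ltnW tT) mE').
have [phi mphi [N [mN N0 phiE]]] := belief_update hpi t_bounds.
pose Phi (z : bool * R * Y1) := (z.1.1, phi (z.1.2, z.2)).
have mPhi : measurable_fun setT Phi.
  apply: measurable_fun_pair.
    exact: (measurableT_comp measurable_fst measurable_fst).
  apply: (measurableT_comp mphi); apply: measurable_fun_pair => //.
  exact: (measurableT_comp measurable_snd measurable_fst).
apply/funext => A; rewrite /cond_law; case: ifPn => // /asboolP mA.
(* Outside of the negligible event [N] the two events coincide. *)
have upd (F : set Omega) : measurable (F : set (past t)) ->
  P (lift_event F `&` belief_event M pi t.+1 A) =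
  P (lift_event F `&` state_and_obs @^-1` (Phi @^-1` A)).
  move=> mF.
  have mlF : measurable (lift_event F) by apply: (past_lift (ltnW tT) mF).
  have mlN : measurable (lift_event N) by apply: measurable_lift.
  have m1 : measurable (lift_event F `&` belief_event M pi t.+1 A).
    by apply: measurableI => //; exact: (measurable_belief_event hpi (t := t.+1) tT mA).
  have m2 : measurable (lift_event F `&` state_and_obs @^-1` (Phi @^-1` A)).
    apply: measurableI => //; apply: measurable_preimageT; first exact: measurable_state_and_obs.
    exact: measurable_preimageT.
  have drop (U V : set (bool * Omega)) : measurable U -> measurable V ->
      U `\` lift_event N `<=` V -> (P U <= P V)%E.
    move=> mU mV UV; apply: (@le_trans _ _ (P (V `|` lift_event N))).
      apply: le_measure; rewrite ?inE//; first exact: measurableU.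
      move=> x Ux; have [Nx|Nx] := pselect (lift_event N x); [by right|left].
      exact: UV.
    by rewrite -[leRHS]adde0 -N0; exact: measureU2.
  apply/eqP; rewrite eq_le !drop//.
    move=> x [[Fx +] /phiE piE]; rewrite /belief_event /state_and_obs /Phi /belief1/=.
    by rewrite piE.
  move=> x [[Fx +] /phiE piE]; rewrite /belief_event /state_and_obs /Phi /belief1/=.
  by rewrite piE.
have mPA : measurable (Phi @^-1` A) by exact: measurable_preimageT.
have := cond_next_eq mE mE' EE' mPA; rewrite -!upd// => /(congr1 fine).
have finP (F : set Omega) : measurable (F : set (past t)) ->
    P (lift_event F `&` belief_event M pi t.+1 A) \is a fin_num.
  move=> mF; rewrite upd// fin_prob//.
  apply: measurableI; first exact: (past_lift (ltnW tT) mF).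
  by apply: measurable_preimageT => //; exact: measurable_state_and_obs.
rewrite !fineM ?finP//= => H.
by rewrite mulrC [RHS]mulrC.
Qed.

End next_information_state.

(** * Stopping events and the total cost *)

(** Both stopping times are given by [find] on an interval of times. *)
Lemma find_iotaP (a : pred nat) m n k : (k < n)%N ->
  find a (iota m n) = k <-> a (m + k)%N /\ (forall j, (j < k)%N -> ~~ a (m + j)%N).
Proof.
move=> kn; split=> [fk|[ak bef]].
  split=> [|j jk].
    have := @nth_find _ 0%N a (iota m n).
    by rewrite has_find size_iota fk nth_iota//; exact.
  have := @before_find _ 0%N a (iota m n) j.
  by rewrite fk jk nth_iota ?(ltn_trans jk)// => ->.
apply/eqP; rewrite eqn_leq; apply/andP; split; rewrite leqNgt; apply/negP => H.
  have := before_find 0%N H.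
  by rewrite nth_iota// ak.
have hs : has a (iota m n) by rewrite has_find size_iota (ltn_trans H).
have := nth_find 0%N hs; rewrite nth_iota ?(ltn_trans H)//.
by rewrite (negbTE (bef _ H)).
Qed.

Arguments find_iotaP a m {n k} kn.

Lemma measurable_forall_lt d (T : measurableType d) (A : nat -> set T) k :
  (forall j, (j < k)%N -> measurable (A j)) ->
  measurable [set w | forall j, (j < k)%N -> A j w].
Proof.
elim: k => [|k IH] mA; first by rewrite (_ : mkset _ = setT)//; apply/seteqP; split.
rewrite (_ : mkset _ = [set w | forall j, (j < k)%N -> A j w] `&` A k).
  by apply: measurableI; [apply: IH => j jk; apply: mA; exact: ltnW|exact: mA].
apply/seteqP; split=> w /=.
  by move=> H; split=> [j jk|]; apply: H => //; exact: ltnW.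
by move=> [H Hk] j; rewrite ltnS leq_eqVlt => /orP[/eqP->//|]; exact: H.
Qed.

Section cost_of_policies.
Context (R : realType) d d1 d2 (Omega : measurableType d)
  (Y1 : measurableType d1) (Y2 : measurableType d2).
Variable M : model R Omega Y1 Y2.
Local Notation P := (joint (law M) (prior M)).
Local Notation past t := (history (obs1 M) t).
Local Notation data2 := (history (obs2 M) (T2 M)).

Section second_observer.
Variable u : policy2 Y2.
Hypothesis adm : admissible2 M u.

Lemma tau2_le w : (tau2 M u w <= T2 M)%N.
Proof.
rewrite /tau2; set a := (fun k => _).
rewrite -ltnS -[in X in (_ < X)%N](size_iota 0 (T2 M).+1).
rewrite -has_find; apply/hasP; exists (T2 M); first by rewrite mem_iota add0n ltnSn.
by rewrite /a; case: adm => _ /(_ (hist2 M (T2 M) w)); case: (u _).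
Qed.

Definition stop2 k v : set Omega := [set w | tau2 M u w = k /\ decision2 M u w = v].

Lemma stop2E k v : (k <= T2 M)%N -> stop2 k v =
  [set w | forall j, (j < k)%N -> u (hist2 M j w) = None] `&`
  [set w | u (hist2 M k w) = Some v].
Proof.
move=> kT; rewrite /stop2 /decision2; apply/seteqP; split=> w /= [].
  move=> tk dec.
  have [/(_ tk)[/=] uk bef _] :=
    find_iotaP (fun j => isSome (u (hist2 M j w))) 0 (kT : (k < (T2 M).+1)%N).
  split=> [j /bef|]; first by rewrite add0n; case: (u _).
  by move: uk dec; rewrite tk add0n; case: (u _) => //= v' _ ->.
move=> bef uk.
have tk : tau2 M u w = k.
  apply/(find_iotaP (fun j => isSome (u (hist2 M j w))) 0
    (kT : (k < (T2 M).+1)%N)); rewrite add0n uk; split => // j jk.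
  by rewrite add0n bef.
by rewrite tk uk.
Qed.

Lemma measurable_stop2 k v : measurable (stop2 k v : set data2).
Proof.
have mu j v' : (j <= T2 M)%N ->
    measurable ([set w | u (hist2 M j w) = v'] : set data2).
  move=> jT; case: adm => /(_ j v' jT) mA _.
  have := measurable_history_tuple (X := obs2 M) jT measurableT mA.
  by rewrite setTI.
have [kT|kT] := leqP k (T2 M).
  rewrite stop2E//; apply: measurableI; last exact: mu.
  by apply: measurable_forall_lt => j jk; apply: mu; rewrite (leq_trans (ltnW jk)).
rewrite (_ : stop2 k v = set0); first exact: measurable0.
apply/seteqP; split=> w //= -[tk _].
by have := tau2_le w; rewrite tk leqNgt kT.
Qed.

End second_observer.

Variable pi : forall t, t.-tuple Y1 -> R.
Hypothesis hpi : is_belief1 M pi.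

Section first_observer.
Variable g : policy1 R.

Local Notation tau w := (tau1 M pi g (false, w)).

Lemma tau1_le w : (tau w <= T1 M)%N.
Proof.
rewrite /tau1; set a := (fun k => _).
rewrite -[in X in (_ < X)%N](size_iota 1 (T1 M)).
rewrite -has_find; apply/hasP; exists (T1 M).
  by rewrite mem_iota T1_gt0 add1n ltnSn.
by rewrite /a /message ltnn.
Qed.

(** As [tau1] is at least 1, this event is empty for [s = 0]. *)
Definition stop1 s z : set Omega :=
  [set w | tau w = s /\ message M pi g s (false, w) = Some z].

Lemma stop1_0 z : stop1 0 z = set0.
Proof. by apply/seteqP; split => // w []. Qed.

Lemma stop1E s z : (1 <= s <= T1 M)%N ->
  stop1 s z = silent M pi g s.-1 `&` rule_event M pi g s (Some z).
Proof.
case: s => // s /= sT; rewrite /stop1; apply/seteqP; split=> w /= [].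
  move=> ts msg.
  have [/(_ (succn_inj ts))[_ bef] _] :=
    find_iotaP (fun j => isSome (message M pi g j (false, w))) 1 sT.
  split => // j /andP[j1 js].
  have := bef j.-1; rewrite add1n prednK// => /(_ js).
  by rewrite -[message _ _ _ _ _]/(rule M g j (pi (hist1 M j w))) /rule_event/=;
    case: (rule _ _ _ _).
move=> bef msg; split=> //; congr _.+1.
apply/(find_iotaP (fun j => isSome (message M pi g j (false, w))) 1 sT).
rewrite add1n; split => [|j js]; first by rewrite [message _ _ _ _ _]msg.
by rewrite add1n [message _ _ _ _ _]bef.
Qed.

Lemma measurable_stop1 s z : (1 <= s <= T1 M)%N ->
  measurable (stop1 s z : set (past (T1 M))).
Proof.
move=> sT; have [s1 sT'] := andP sT; rewrite stop1E//; apply: measurableI.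
  by apply: measurable_silent => //; rewrite (leq_trans (leq_pred _)).
exact: measurable_rule_event.
Qed.

(** The only transcript with which O1 can stop at time [s] with message [z]. *)
Definition reply s z := rcons (nseq s.-1 None) (Some z) : seq (option bool).

Lemma transcript_stop1 s z x : stop1 s z x.2 -> transcript M pi g x = reply s z.
Proof.
move=> [ts msg]; rewrite /transcript [tau1 _ _ _ _](_ : _ = tau x.2)// ts.
case: s ts msg => // s [ts] msg.
rewrite -[s.+1]addn1 iotaD cats1 map_rcons add1n [X in rcons _ X]msg /reply addn1/=.
congr rcons; apply: (@eq_from_nth _ None); first by rewrite size_map size_iota size_nseq.
rewrite size_map size_iota => i it.
rewrite (nth_map 0%N) ?size_iota// nth_iota// nth_nseq it.
have := @before_find _ 0%N (fun t => isSome (message M pi g t (false, x.2)))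
  (iota 1 (T1 M)) i.
rewrite ts => /(_ it); rewrite nth_iota; last first.
  by have := tau1_le x.2; rewrite /tau1 ts => /ltnW; exact: leq_trans.
by rewrite [message _ _ _ _ x](_ : _ = message M pi g (1 + i) (false, x.2))//; case: message.
Qed.

Lemma transcript_reply s z : (1 <= s)%N ->
  [set x | transcript M pi g x = reply s z] = lift_event (stop1 s z).
Proof.
move=> s1; apply/seteqP; split=> x /=; last exact: transcript_stop1.
have sz : size (reply s z) = s by rewrite size_rcons size_nseq prednK.
move=> tr; have ts : tau x.2 = s.
  by rewrite -sz -tr size_map size_iota.
split=> //; have := congr1 (nth None ^~ s.-1) tr.
rewrite /transcript (nth_map 0%N); last first.
  by rewrite size_iota [tau1 _ _ _ _]ts prednK.
rewrite nth_iota; last by rewrite [tau1 _ _ _ _]ts prednK.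
rewrite add1n prednK// /reply nth_rcons size_nseq ltnn eqxx; exact.
Qed.

End first_observer.
End cost_of_policies.

Section cost_decomposition.
Context (R : realType) d d1 d2 (Omega : measurableType d)
  (Y1 : measurableType d1) (Y2 : measurableType d2).
Variable M : model R Omega Y1 Y2.
Local Notation P := (joint (law M) (prior M)).
Variable pi : forall t, t.-tuple Y1 -> R.
Hypothesis hpi : is_belief1 M pi.
Variable wald : R -> policy2 Y2.
Hypothesis hwald : is_wald_policy M wald.

Lemma wald_admissible q : 0 <= q <= 1 -> admissible2 M (wald q).
Proof. by move=> /hwald[]. Qed.

Definition total_cost (s k : nat) (v h : bool) : R :=
  c1 M * s%:R + c2 M * k%:R + J M v h.

Lemma total_cost_ge0 s k v h : 0 <= total_cost s k v h.
Proof.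
have c10 := ltW (c1_gt0 M); have c20 := ltW (c2_gt0 M).
have J0 : 0 <= J M v h by case/andP: (J_bounded M v h).
by rewrite /total_cost !addr_ge0// mulr_ge0.
Qed.

(** The mean total cost given [H = h] when O1 stops at time [s] and O2 then plays
from the belief [q]; [mean_cost_after] averages it over the law of [H] given by
[q]. *)
Definition cost_after s q h : R :=
  \sum_(k < (T2 M).+1) \sum_(v : bool)
    total_cost s k v h * fine (law M h (stop2 M (wald q) k v)).

Definition mean_cost_after s q : R := \sum_(h : bool) hyp_prob q h * cost_after s q h.

Lemma mean_cost_after_ge0 s q : 0 <= q <= 1 -> 0 <= mean_cost_after s q.
Proof.
move=> q01; apply: sumr_ge0 => h _; rewrite mulr_ge0 ?hyp_prob_ge0//.
apply: sumr_ge0 => k _; apply: sumr_ge0 => v _.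
by rewrite mulr_ge0 ?total_cost_ge0// fine_ge0.
Qed.

Definition stop_prob g s z : R := fine (P (lift_event (stop1 M pi g s z))).

Definition final_belief g s z : R := belief2 M pi g (reply s z).

Lemma measurable_stop1_Omega g s z : (s <= T1 M)%N -> measurable (stop1 M pi g s z).
Proof.
case: s => [|s] sT; first by rewrite stop1_0.
exact: (past_measurable (leqnn _) (measurable_stop1 hpi g z (s := s.+1) sT)).
Qed.

Lemma measurable_stop2_Omega u k v : admissible2 M u ->
  measurable (stop2 M u k v).
Proof. by move=> adm; exact: (data2_measurable (measurable_stop2 adm k v)). Qed.

Lemma stop_prob_by_hyp g s z : (s <= T1 M)%N ->
  stop_prob g s z =
  \sum_(h : bool) hyp_prob (prior M) h * fine (law M h (stop1 M pi g s z)).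
Proof.
move=> sT; have mS := measurable_stop1_Omega g z sT.
have secE h : xsection (lift_event (stop1 M pi g s z)) h = stop1 M pi g s z.
  by apply/seteqP; split=> w; rewrite /xsection/= inE.
rewrite /stop_prob (joint_sum _ (prior01 M)) !big_bool/= !secE fineD; last 2 first.
- by rewrite fin_numM// fin_prob.
- by rewrite fin_numM// fin_prob.
by rewrite !fineM ?fin_prob.
Qed.

Lemma final_beliefE g s z : (1 <= s)%N -> final_belief g s z =
  fine (P (lift_event (stop1 M pi g s z) `&` [set x | x.1 = false])) / stop_prob g s z.
Proof.
move=> s1; rewrite /final_belief /belief2.
rewrite (_ : [set x | x.1 = false /\ transcript M pi g x = reply s z] =
  lift_event (stop1 M pi g s z) `&` [set x | x.1 = false]).
  by rewrite transcript_reply.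
by rewrite -transcript_reply// setIC.
Qed.

Lemma final_belief01 g s z : (1 <= s <= T1 M)%N -> 0 <= final_belief g s z <= 1.
Proof.
move=> /andP[s1 sT]; have mS := measurable_stop1_Omega g z sT.
have ml := measurable_lift mS.
have mh : measurable [set x : bool * Omega | x.1 = false].
  exact: (@measurable_preimageT _ _ _ _ (@fst bool Omega) [set false]).
rewrite final_beliefE// divr_ge0 ?fine_ge0//=.
have [->|p0] := eqVneq (stop_prob g s z) 0; first by rewrite invr0 mulr0.
rewrite ler_pdivrMr ?mul1r; last by rewrite lt_neqAle eq_sym p0 fine_ge0.
by rewrite fine_le ?fin_prob//;
  [apply: measurableI|apply: le_measure; rewrite ?inE//; exact: measurableI].
Qed.

(** Bayes' rule for the event that O1 stops at [s] with [z]; it replaces the prior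
by the belief with which O2 starts. *)
Lemma final_belief_hyp_prob g s z h : (1 <= s <= T1 M)%N ->
  hyp_prob (prior M) h * fine (law M h (stop1 M pi g s z)) =
  stop_prob g s z * hyp_prob (final_belief g s z) h.
Proof.
move=> /andP[s1 sT]; have mS := measurable_stop1_Omega g z sT.
have ml := measurable_lift mS.
have E0 : hyp_prob (prior M) false * fine (law M false (stop1 M pi g s z)) =
    stop_prob g s z * hyp_prob (final_belief g s z) false.
  rewrite [in RHS]/hyp_prob final_beliefE//.
  have -> : lift_event (stop1 M pi g s z) `&` [set x | x.1 = false] =
      [set x | x.1 = false /\ stop1 M pi g s z x.2] by rewrite setIC.
  rewrite joint_slice ?prior01// fineM ?fin_prob//=.
  have [p0|p0] := eqVneq (stop_prob g s z) 0; last by rewrite [RHS]mulrC divfK.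
  have := stop_prob_by_hyp g z sT; rewrite p0 big_bool/= => /esym/eqP.
  rewrite paddr_eq0 ?mulr_ge0 ?hyp_prob_ge0 ?prior01 ?fine_ge0// => /andP[_ /eqP->].
  by rewrite mul0r.
case: h => //.
have := stop_prob_by_hyp g z sT; rewrite big_bool/= E0 => H.
rewrite {2}/hyp_prob mulrBr mulr1 {1}H; rewrite [in RHS]/hyp_prob addrK//.
Qed.

(** The cost is a function of the finite label (stopping time and message of O1,
hypothesis, stopping time and decision of O2).  The probability of a label factors
by the conditional independence of the two observers given the hypothesis, since
O2's policy is fixed once the stopping time and the message of O1 are. *)
Lemma cost_decomposition g :
  cost M pi wald g =
  (\sum_(1 <= s < (T1 M).+1) \sum_(z : bool)
     stop_prob g s z * mean_cost_after s (final_belief g s z))%:E.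
Proof.
pose msg x := odflt false (message M pi g (tau1 M pi g x) x).
pose u2 x := wald (belief2 M pi g (transcript M pi g x)).
pose I : finType := ('I_(T1 M).+1 * bool * bool * 'I_(T2 M).+1 * bool)%type.
pose l x : I := (inord (tau1 M pi g x), msg x, x.1,
   inord (tau2 M (u2 x) x.2), decision2 M (u2 x) x.2).
pose v (i : I) := let: (s, z, h, k, v) := i in total_cost s k v h.
have tau1_ge1 x : (1 <= tau1 M pi g x)%N by [].
have msgE x : message M pi g (tau1 M pi g x) x = Some (msg x).
  have has_msg : has (fun t => isSome (message M pi g t x)) (iota 1 (T1 M)).
    by rewrite has_find size_iota; exact: (tau1_le M pi g x.2).
  have := nth_find 0%N has_msg; rewrite nth_iota; last first.
    exact: (tau1_le M pi g x.2).
  by rewrite add1n -/(tau1 M pi g x) /msg; case: (message _ _ _ _ _).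
have stopE x : stop1 M pi g (tau1 M pi g x) (msg x) x.2.
  by split => //; exact: msgE.
have tau1T x : (tau1 M pi g x <= T1 M)%N := tau1_le M pi g x.2.
have u2E x : u2 x = wald (final_belief g (tau1 M pi g x) (msg x)).
  by rewrite /u2 /final_belief (transcript_stop1 (stopE x)).
have u2adm x : admissible2 M (u2 x).
  by rewrite u2E; apply: wald_admissible; apply: final_belief01; rewrite tau1_ge1 tau1T.
pose event (i : I) : set (bool * Omega) := let: (s, z, h, k, v) := i in
  [set x | x.1 = h /\ (stop1 M pi g s z `&`
     stop2 M (wald (final_belief g s z)) k v) x.2].
have eventE i : l @^-1` [set i] = event i.
  case: i => -[[[s z] h] k] v'; apply/seteqP; split=> x /=.
    case=> <- <- <- <- <-; rewrite !inordK ?ltnS//; last exact: tau2_le.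
    by split=> //; split; [exact: stopE|rewrite -u2E].
  move=> [xh [Hs [tk dk]]]; have [ts ms] := Hs.
  have tsx : tau1 M pi g x = s by [].
  have mx : msg x = z by rewrite /msg tsx [message _ _ _ _ _]ms.
  have ux : u2 x = wald (final_belief g s z) by rewrite u2E tsx mx.
  by rewrite /l tsx mx ux tk dk xh !inord_val.
have mev i : measurable (event i).
  case: i => -[[[s z] h] k] v' /=; 
  apply: (measurable_slice h (A := stop1 M pi g s z `&`
    stop2 M (wald (final_belief g s z)) k v')).
  have [s0|s0] := posnP s; first by rewrite s0 stop1_0 set0I; exact: measurable0.
  have sT : (s <= T1 M)%N by rewrite -ltnS.
  apply: measurableI; first exact: measurable_stop1_Omega.
  apply: measurable_stop2_Omega; apply: wald_admissible.
  by apply: final_belief01; rewrite s0.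
rewrite /cost /expected_cost.
transitivity (\int[P]_x (v (l x))%:E)%E.
  apply: eq_integral => x _; rewrite /v /l/= /total_cost.
  by rewrite (@inordK (T1 M)) ?ltnS ?tau1T// (@inordK (T2 M)) ?ltnS ?tau2_le.
apply: etrans.
  apply: (@integral_finite_range _ _ _ P I l v) => [i|]; first by rewrite eventE.
  by move=> [[[[s z] h] k] v']; exact: total_cost_ge0.
congr (_%:E).
under eq_bigr do rewrite eventE.
transitivity (\sum_(s < (T1 M).+1) \sum_(z : bool) \sum_(h : bool)
   \sum_(k < (T2 M).+1) \sum_(v' : bool)
     v (s, z, h, k, v') * fine (P (event (s, z, h, k, v')))).
  by rewrite !pair_bigA/=; apply: eq_bigr => -[[[[s z] h] k] v'].
transitivity (\sum_(0 <= s < (T1 M).+1) \sum_(z : bool)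
     stop_prob g s z * mean_cost_after s (final_belief g s z)); last first.
  rewrite big_ltn// big1 ?add0r// => z _.
  by rewrite /stop_prob stop1_0 (_ : lift_event set0 = set0)// measure0 mul0r.
rewrite big_mkord; apply: eq_bigr => s _; apply: eq_bigr => z _.
have [s0|s0] := posnP s.
  rewrite big1 => [|h _].
    by rewrite /stop_prob s0 stop1_0 (_ : lift_event set0 = set0)// measure0 mul0r.
  rewrite big1 // => k _; rewrite big1// => v' _.
  rewrite /event s0 stop1_0 set0I (_ : mkset _ = set0) ?measure0 ?mulr0//.
  by apply/seteqP; split=> // x [].
have sT : (1 <= s <= T1 M)%N by rewrite s0 -ltnS ltn_ord.
rewrite /mean_cost_after mulr_sumr; apply: eq_bigr => h _.
rewrite mulrA -final_belief_hyp_prob// /cost_after mulr_sumr; apply: eq_bigr => k _.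
rewrite mulr_sumr; apply: eq_bigr => v' _.
rewrite /event joint_slice ?prior01// indep_past_data2; last 2 first.
- exact: measurable_stop1.
- by apply: measurable_stop2; apply: wald_admissible; exact: final_belief01.
have mS2 : measurable (stop2 M (wald (final_belief g s z)) k v').
  apply: measurable_stop2_Omega; apply: wald_admissible.
  exact: final_belief01.
have mS1 : measurable (stop1 M pi g s z).
  by apply: measurable_stop1_Omega; case/andP: sT.
rewrite !fineM ?fin_numM ?fin_prob//= mulrCA -[RHS]mulrA; congr (_ * _).
exact: mulrCA.
Qed.

End cost_decomposition.

(** * Cost to go *)

Section dynamic_programming.
Context (R : realType) d d1 d2 (Omega : measurableType d)
  (Y1 : measurableType d1) (Y2 : measurableType d2).
Variable M : model R Omega Y1 Y2.
Local Notation P := (joint (law M) (prior M)).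
Variable pi : forall t, t.-tuple Y1 -> R.
Hypothesis hpi : is_belief1 M pi.
Variable wald : R -> policy2 Y2.
Hypothesis hwald : is_wald_policy M wald.

Definition reach_prob g t : R := fine (P (blanks M pi g t.-1)).

Lemma reachableE g t : (t <= T1 M)%N -> reachable M pi g t <-> 0 < reach_prob g t.
Proof.
move=> tT; have mB : measurable (blanks M pi g t.-1).
  by apply: (measurable_blanks hpi); rewrite (leq_trans (leq_pred _)).
rewrite /reachable /reach_prob -[in X in (X <-> _)](fineK (fin_prob P mB)).
by rewrite lte_fin.
Qed.

Lemma stop_event g t z : (1 <= t <= T1 M)%N -> lift_event (stop1 M pi g t z) =
  blanks M pi g t.-1 `&` belief_event M pi t [set x | rule M g t x.2 = Some z].
Proof. by move=> tT; rewrite stop1E. Qed.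

Lemma silent_event g t : (1 <= t)%N -> blanks M pi g t =
  blanks M pi g t.-1 `&` belief_event M pi t [set x | rule M g t x.2 = None].
Proof. exact: blanksS. Qed.

Lemma measurable_rule2 g t z : measurable [set x : bool * R | rule M g t x.2 = z].
Proof.
exact: (@measurable_preimageT _ _ _ _ (@snd bool R) _ _ (measurable_rule M g t z)).
Qed.

(** Also valid when the time [t] is not reached, both sides being zero. *)
Lemma reach_prob_xi g t A : (1 <= t <= T1 M)%N -> measurable A ->
  fine (P (blanks M pi g t.-1 `&` belief_event M pi t A)) =
  reach_prob g t * xi_law M pi g t A.
Proof.
move=> tT mA; have mB : measurable (blanks M pi g t.-1).
  by case/andP: tT => _ tT; apply: (measurable_blanks hpi); rewrite (leq_trans (leq_pred _)).
rewrite /xi_law cond_lawE// -/(reach_prob g t) [RHS]mulrC.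
have [p0|p0] := eqVneq (reach_prob g t) 0; last by rewrite divfK.
rewrite p0 mulr0; apply/eqP; rewrite eq_le fine_ge0// andbT -p0.
have mBA := measurableI _ _ mB (measurable_belief_event hpi tT mA).
by rewrite fine_le ?fin_prob// le_measure ?inE.
Qed.

Lemma stop_prob_xi g t z : (1 <= t <= T1 M)%N ->
  stop_prob M pi g t z =
  reach_prob g t * xi_law M pi g t [set x | rule M g t x.2 = Some z].
Proof.
move=> tT; rewrite -reach_prob_xi//; last exact: measurable_rule2.
by rewrite -stop_event.
Qed.

Lemma reach_probS g t : (1 <= t <= T1 M)%N ->
  reach_prob g t.+1 =
  reach_prob g t * xi_law M pi g t [set x | rule M g t x.2 = None].
Proof.
move=> tT; rewrite -reach_prob_xi//; last exact: measurable_rule2.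
by rewrite -silent_event//; case/andP: tT.
Qed.

Lemma final_belief_xi g t z : (1 <= t <= T1 M)%N ->
  final_belief M pi g t z =
  filtered_law (xi_law M pi g t) [set q | rule M g t q = Some z] [set x | x.1 = false].
Proof.
move=> tT; rewrite -eta_lawE// /eta_law cond_lawE; last first.
  exact: (@measurable_preimageT _ _ _ _ (@fst bool R) [set false]).
rewrite final_beliefE; last by case/andP: tT.
by rewrite /stop_prob stop_event.
Qed.

(** The contribution of stopping at time [t], from the state [l] with the decision
rule [r]. *)
Definition stage_cost t (l : joint_law_type R) (r : R -> option bool) : R :=
  \sum_(z : bool) l [set x | r x.2 = Some z] *
    mean_cost_after M wald t
      (filtered_law l [set q | r q = Some z] [set x | x.1 = false]).

Definition tail_cost g t : R := \sum_(t <= s < (T1 M).+1) \sum_(z : bool)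
  stop_prob M pi g s z * mean_cost_after M wald s (final_belief M pi g s z).

(** The conditional mean of the total cost, time before [t] included, given that
[t] is reached. *)
Definition cost_to_go g t : R := tail_cost g t / reach_prob g t.

Lemma reach_prob_mono g s t : (1 <= s <= t)%N -> (t <= (T1 M).+1)%N ->
  reach_prob g t <= reach_prob g s.
Proof.
case: s t => [|s] [|t]//; rewrite !ltnS /= => st tT.
rewrite /reach_prob/= fine_le ?fin_prob//.
- by apply: (measurable_blanks hpi).
- by apply: (measurable_blanks hpi); rewrite (leq_trans st).
apply: le_measure; rewrite ?inE.
- by apply: (measurable_blanks hpi).
- by apply: (measurable_blanks hpi); rewrite (leq_trans st).
by move=> x H j /andP[j1 js]; apply: H; rewrite j1 (leq_trans js).
Qed.

Lemma tail_cost_ge0 g t : (1 <= t)%N -> 0 <= tail_cost g t.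
Proof.
move=> t1; rewrite /tail_cost big_nat; apply: sumr_ge0 => s /andP[ts sT].
apply: sumr_ge0 => z _; rewrite mulr_ge0 ?fine_ge0//.
apply: mean_cost_after_ge0; apply: (final_belief01 hpi).
by rewrite (leq_trans t1 ts).
Qed.

Lemma cost_to_go_ge0 g t : (1 <= t)%N -> 0 <= cost_to_go g t.
Proof. by move=> t1; rewrite divr_ge0 ?tail_cost_ge0// fine_ge0. Qed.

Lemma tail_cost_unreachable g t : (1 <= t)%N -> reach_prob g t = 0 ->
  tail_cost g t = 0.
Proof.
move=> t1 p0; rewrite /tail_cost big_nat big1// => s /andP[ts sT].
have s0 : reach_prob g s = 0.
  apply/eqP; rewrite eq_le fine_ge0// andbT -p0.
  by apply: reach_prob_mono; rewrite ?t1// ltnW.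
rewrite big1// => z _; rewrite stop_prob_xi ?s0 ?mul0r//.
by rewrite (leq_trans t1 ts).
Qed.

Lemma tail_cost_step g t : (1 <= t <= T1 M)%N ->
  tail_cost g t =
  reach_prob g t * stage_cost t (xi_law M pi g t) (rule M g t) + tail_cost g t.+1.
Proof.
move=> tT; rewrite /tail_cost big_ltn; last by case/andP: tT.
congr (_ + _); rewrite mulr_sumr; apply: eq_bigr => z _.
by rewrite stop_prob_xi// final_belief_xi// mulrA.
Qed.

Lemma cost_to_go_step g t : (1 <= t <= T1 M)%N -> 0 < reach_prob g t ->
  cost_to_go g t = stage_cost t (xi_law M pi g t) (rule M g t) +
    xi_law M pi g t [set x | rule M g t x.2 = None] * cost_to_go g t.+1.
Proof.
move=> tT p0; have pn : reach_prob g t != 0 by rewrite gt_eqF.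
rewrite {1}/cost_to_go tail_cost_step// mulrDl mulrAC divff// mul1r; congr (_ + _).
rewrite /cost_to_go reach_probS//.
have [x0|x0] := eqVneq (xi_law M pi g t [set x | rule M g t x.2 = None]) 0.
  rewrite x0 mul0r tail_cost_unreachable ?mul0r//.
  by rewrite reach_probS// x0 mulr0.
by rewrite invfM mulrCA [_ * (_^-1 * _)]mulrCA divff// mulr1.
Qed.

Lemma cost_to_go_end g : cost_to_go g (T1 M).+1 = 0.
Proof. by rewrite /cost_to_go /tail_cost big_geq ?mul0r. Qed.

Definition same_future (g g' : policy1 R) t : Prop :=
  (forall s, (t <= s < T1 M)%N -> thr g s = thr g' s) /\ last_thr g = last_thr g'.

Lemma rule_same_future g g' t : same_future g g' t -> rule M g t = rule M g' t.
Proof.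
move=> [tE lE]; apply/funext => q; rewrite /rule lE.
by case: ifP => // tT; rewrite tE// leqnn.
Qed.

Lemma same_futureS g g' t : same_future g g' t -> same_future g g' t.+1.
Proof. by move=> [tE lE]; split=> // s /andP[/ltnW ts sT]; apply: tE; rewrite ts. Qed.

Lemma xi_step g g' t : (1 <= t < T1 M)%N ->
  xi_law M pi g t = xi_law M pi g' t -> thr g t = thr g' t ->
  xi_law M pi g t.+1 = xi_law M pi g' t.+1.
Proof.
by move=> tT xiE tE; apply: (xi_law_eta hpi tT); exact: (eta_law_eq hpi).
Qed.

Lemma xi_silent_ge0 g t :
  0 <= xi_law M pi g t [set x | rule M g t x.2 = None].
Proof.
rewrite /xi_law cond_lawE; last exact: measurable_rule2.
by rewrite divr_ge0 ?fine_ge0.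
Qed.

Lemma reach_prob_gt0S g t : (1 <= t <= T1 M)%N ->
  0 < reach_prob g t ->
  (0 < reach_prob g t.+1) =
  (0 < xi_law M pi g t [set x | rule M g t x.2 = None]).
Proof. by move=> tT p0; rewrite reach_probS// pmulr_rgt0. Qed.

(** Induction on the remaining time: the state and the current thresholds fix the
stage cost, the probability of going on and the next state. *)
Lemma cost_to_go_future g g' t : (1 <= t <= T1 M)%N ->
  0 < reach_prob g t -> 0 < reach_prob g' t ->
  xi_law M pi g t = xi_law M pi g' t -> same_future g g' t ->
  cost_to_go g t = cost_to_go g' t.
Proof.
have [n] := ubnP (T1 M - t)%N; elim: n t => // n IH t tn tT p0 p0' xiE fut.
rewrite (cost_to_go_step tT p0) (cost_to_go_step tT p0') xiE -(rule_same_future fut).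
congr (_ + _ * _).
have /andP[t1] := tT; rewrite leq_eqVlt => /orP[/eqP ->|ltT].
  by rewrite !cost_to_go_end.
have xiS : xi_law M pi g t.+1 = xi_law M pi g' t.+1.
  by apply: xi_step; rewrite ?t1//; case: fut => + _; apply; rewrite leqnn.
have reachE : (0 < reach_prob g t.+1) = (0 < reach_prob g' t.+1).
  rewrite (reach_prob_gt0S tT p0) (reach_prob_gt0S tT p0') xiE.
  by rewrite (rule_same_future fut).
have [q0|q0] := boolP (0 < reach_prob g t.+1).
  apply: IH => //.
  - by rewrite subnS -ltnS prednK ?subn_gt0.
  - by rewrite -reachE.
  - exact: same_futureS.
have q0' : ~~ (0 < reach_prob g' t.+1).
  by rewrite -reachE.
have zero k : ~~ (0 < reach_prob k t.+1) -> cost_to_go k t.+1 = 0.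
  rewrite lt0r fine_ge0// andbT negbK => /eqP k0.
  by rewrite /cost_to_go tail_cost_unreachable// mul0r.
by rewrite (zero g q0) (zero g' q0').
Qed.

End dynamic_programming.

(** * Optimal thresholds *)

Lemma inf_ge0 (R : realType) (S : set R) : (forall x, S x -> 0 <= x) -> 0 <= inf S.
Proof.
move=> S0; have [->|/set0P S1] := eqVneq S set0; first by rewrite inf0.
exact: lb_le_inf.
Qed.

Lemma ereal_inf_image (R : realType) (A : Type) (D : set A) (r : A -> R) a :
  D a -> (forall a, 0 <= r a) ->
  (inf [set r a | a in D])%:E = ereal_inf [set (r a)%:E | a in D].
Proof.
move=> Da r0; rewrite -ereal_inf_EFin; last by exists (r a), a.
  by rewrite image_comp.
by exists 0 => _ [b _ <-].
Qed.

(** Minimizing in two steps: the parameter of [g] attains the outer infimum if and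
only if the inner infimum at this parameter bounds all the values from below.  Every
parameter in [D] must be that of some element of [C], for otherwise the infimum of
the empty set, which is 0, would enter the outer infimum. *)
Lemma inner_inf_minimal (R : realType) (K A : Type) (C : set K) (D : set A)
    (param : K -> A) (V : K -> R) (g : K) :
  (forall k, C k -> 0 <= V k) -> (forall k, C k -> D (param k)) ->
  (forall a, D a -> exists2 k, C k & param k = a) -> C g ->
  let r a := inf [set V k | k in [set k | C k /\ param k = a]] in
  r (param g) = inf [set r a | a in D] <-> (forall k, C k -> r (param g) <= V k).
Proof.
move=> V0 CD DC Cg r.
have rle k : C k -> r (param k) <= V k.
  move=> Ck; apply: ge_inf; last by exists k.
  by exists 0 => _ [k' [Ck' _] <-]; exact: V0.
have r0 a : 0 <= r a by apply: inf_ge0 => _ [k [Ck _] <-]; exact: V0.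
have lbr : has_lbound [set r a | a in D] by exists 0 => _ [a _ <-].
split=> [-> k Ck|minr].
  apply: le_trans (rle _ Ck); apply: ge_inf => //.
  by exists (param k) => //; exact: CD.
apply/eqP; rewrite eq_le; apply/andP; split.
  apply: lb_le_inf; first by exists (r (param g)), (param g) => //; exact: CD.
  move=> _ [a Da <-]; have [k Ck ka] := DC a Da.
  apply: lb_le_inf; first by exists (V k), k.
  by move=> _ [k' [Ck' _] <-]; exact: minr.
by apply: ge_inf => //; exists (param g) => //; exact: CD.
Qed.

Section optimal_policies.
Context (R : realType) d d1 d2 (Omega : measurableType d)
  (Y1 : measurableType d1) (Y2 : measurableType d2).
Variable M : model R Omega Y1 Y2.
Variable pi : forall t, t.-tuple Y1 -> R.
Hypothesis hpi : is_belief1 M pi.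
Variable wald : R -> policy2 Y2.
Hypothesis hwald : is_wald_policy M wald.

Local Notation V := (cost_to_go M pi wald).
Local Notation reach_prob := (reach_prob M pi).
Local Notation xi := (xi_law M pi).

(** The policies reaching time [t] in the information state [l].  This set is empty
if [l] is not an information state, and the infima below are then 0. *)
Definition in_state t (l : joint_law_type R) : set (policy1 R) :=
  [set g | [/\ admissible1 M g, 0 < reach_prob g t & xi g t = l]].

Definition cost_given_thr t l (a : thresholds R) : R :=
  inf [set V g t | g in [set g | in_state t l g /\ thr g t = a]].

Definition cost_given_last l (a : R) : R :=
  inf [set V g (T1 M) | g in [set g | in_state (T1 M) l g /\ last_thr g = a]].

Definition glue (g k : policy1 R) t : policy1 R :=
  Policy1 (fun s => if (s < t)%N then thr g s else thr k s) (last_thr k).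

Lemma glue_admissible g k t : admissible1 M g -> admissible1 M k ->
  admissible1 M (glue g k t).
Proof.
move=> [g1 g2] [k1 k2]; split => // s sT /=.
by case: ifP => _; [exact: g1|exact: k1].
Qed.

Lemma glue_past g k t : same_past g (glue g k t) t.
Proof. by move=> s /andP[_ st] /=; rewrite st. Qed.

Lemma glue_future g k t : same_future M (glue g k t) k t.
Proof. by split=> // s /andP[ts _] /=; rewrite ltnNge ts. Qed.

Lemma reach_prob_past g k t : (t <= T1 M)%N -> same_past g k t ->
  reach_prob g t = reach_prob k t.
Proof. by move=> tT gk; rewrite /reach_prob (blanks_same_past pi tT gk). Qed.

Definition optimal_given_state t g := forall k, in_state t (xi g t) k -> V g t <= V k t.

Lemma in_state_glue g k t : (1 <= t <= T1 M)%N -> 0 < reach_prob g t ->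
  admissible1 M g -> admissible1 M k -> in_state t (xi g t) (glue g k t).
Proof.
move=> tT p0 ga ka; have [_ tT'] := andP tT; split.
- exact: glue_admissible.
- by rewrite -(reach_prob_past tT' (@glue_past g k t)).
- by apply/esym; apply: xi_law_same_past => //; exact: glue_past.
Qed.

Lemma cost_to_go_glue g k t : (1 <= t <= T1 M)%N -> 0 < reach_prob g t ->
  admissible1 M g -> in_state t (xi g t) k -> V (glue g k t) t = V k t.
Proof.
move=> tT p0 ga [ka k0 kxi]; have [_ g0 gxi] := in_state_glue tT p0 ga ka.
apply: (cost_to_go_future hpi wald tT) => //; first by rewrite gxi kxi.
exact: glue_future.
Qed.

(** The costs of two policies with the same past differ by a positive multiple of
the difference of their costs to go, and every policy in the state of [g] can be
given the past of [g]. *)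
Lemma optimal_from_state g t : admissible1 M g -> (1 <= t <= T1 M)%N ->
  0 < reach_prob g t -> optimal_from M pi wald g t <-> optimal_given_state t g.
Proof.
move=> ga tT p0; have [t1 tT'] := andP tT.
pose past k := \sum_(1 <= s < t) \sum_(z : bool)
  stop_prob M pi k s z * mean_cost_after M wald s (final_belief M pi k s z).
have split_cost k : cost M pi wald k = (past k + tail_cost M pi wald k t)%:E.
  by rewrite cost_decomposition// (big_cat_nat (n := t)) ?leqW.
have pastE k : same_past g k t -> past g = past k.
  move=> gk; apply: eq_big_nat => s /andP[s1 st]; apply: eq_bigr => z _.
  have sT : (1 <= s <= T1 M)%N by rewrite s1 (leq_trans (ltnW st)).
  have gks : same_past g k s.
    by move=> j /andP[j1 js]; apply: gk; rewrite j1 (ltn_trans js).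
  have rE : rule M g s = rule M k s.
    by apply/funext => q; rewrite /rule (leq_trans st tT') gk ?s1.
  rewrite (stop_prob_xi hpi g z sT) (stop_prob_xi hpi k z sT).
  rewrite (final_belief_xi hpi g z sT) (final_belief_xi hpi k z sT) rE.
  rewrite (xi_law_same_past pi sT gks) (@reach_prob_past g k s)//.
  by case/andP: sT.
have cmp k : same_past g k t ->
    (cost M pi wald g <= cost M pi wald k)%E = (V g t <= V k t).
  move=> gk; rewrite (split_cost g) (split_cost k) lee_fin (pastE k gk) lerD2l.
  by rewrite /cost_to_go -(reach_prob_past tT' gk) ler_pM2r// invr_gt0.
split=> [[_ opt] k kA|bst].
  have [ka _ _] := kA.
  rewrite -(cost_to_go_glue tT p0 ga kA) -cmp; last exact: glue_past.
  by apply: opt; [exact: glue_admissible|exact: glue_past].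
split=> [|k ka gk]; first exact: ga.
rewrite (cmp k gk); apply: bst; split; first exact: ka.
- by rewrite -(reach_prob_past tT' gk).
- by apply/esym; exact: (xi_law_same_past pi tT gk).
Qed.

Lemma set_thr_in_state g t a : (1 <= t < T1 M)%N -> admissible1 M g ->
  0 < reach_prob g t -> ordered a ->
  exists2 k, in_state t (xi g t) k & thr k t = a.
Proof.
move=> tT ga p0 oa; have [t1 tT'] := andP tT.
have aa : admissible1 M (Policy1 (fun=> a) (last_thr g)) by split => //; case: ga.
exists (glue g (Policy1 (fun=> a) (last_thr g)) t); last by rewrite /= ltnn.
by apply: in_state_glue => //; rewrite t1 ltnW.
Qed.

Lemma set_last_in_state g a : admissible1 M g ->
  0 < reach_prob g (T1 M) -> 0 <= a <= 1 ->
  exists2 k, in_state (T1 M) (xi g (T1 M)) k & last_thr k = a.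
Proof.
move=> ga p0 oa.
have aa : admissible1 M (Policy1 (thr g) a) by split => //; case: ga.
exists (glue g (Policy1 (thr g) a) (T1 M)) => //.
by apply: in_state_glue => //; rewrite T1_gt0 leqnn.
Qed.

Definition least_cost t l := inf [set cost_given_thr t l a | a in [set a | ordered a]].
Definition least_last_cost l :=
  inf [set cost_given_last l a | a in [set a : R | 0 <= a <= 1]].

(** At the last time the cost to go is a function of the state and of the last
threshold, so that the inner infimum is that of a single value. *)
Lemma optimal_given_state_end g : admissible1 M g -> 0 < reach_prob g (T1 M) ->
  optimal_given_state (T1 M) g <->
  cost_given_last (xi g (T1 M)) (last_thr g) = least_last_cost (xi g (T1 M)).
Proof.
move=> ga p0; have tT : (1 <= T1 M <= T1 M)%N by rewrite T1_gt0 leqnn.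
have gA : in_state (T1 M) (xi g (T1 M)) g by split.
have VE k : in_state (T1 M) (xi g (T1 M)) k -> last_thr k = last_thr g ->
    V k (T1 M) = V g (T1 M).
  move=> [ka k0 kxi] kg; apply: (cost_to_go_future hpi wald tT) => //.
  by split => // s /andP[Ts sT]; move: (leq_ltn_trans Ts sT); rewrite ltnn.
have rE : cost_given_last (xi g (T1 M)) (last_thr g) = V g (T1 M).
  rewrite /cost_given_last (_ : [set _ | _ in _] = [set V g (T1 M)]) ?inf1//.
  by apply/seteqP; split=> [_ [k [kA kg] <-]|_ ->]; [exact: VE|exists g].
have := @inner_inf_minimal R _ _ (in_state (T1 M) (xi g (T1 M)))
  [set a : R | 0 <= a <= 1] (@last_thr R) (V^~ (T1 M)) g.
have V0 k : 0 <= V k (T1 M) by apply: cost_to_go_ge0 => //; exact: T1_gt0.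
move=> /(_ (fun k _ => V0 k)).
move=> /(_ (fun k kA => let: And3 ka _ _ := kA in ka.2)).
move=> /(_ (fun a a01 => set_last_in_state ga p0 a01) gA) /= H.
rewrite -/(cost_given_last _ _) in H.
by rewrite /least_last_cost /= H rE.
Qed.

Lemma rule_thr g k t : (t < T1 M)%N -> thr g t = thr k t -> rule M g t = rule M k t.
Proof. by move=> tT gk; apply/funext => q; rewrite /rule tT gk. Qed.

(** The principle of optimality.  Among policies in the same state with the same
current thresholds, the cost to go is an increasing function of the next one, with
the probability [m] of going on as its slope. *)
Lemma optimal_given_state_step g t :
  admissible1 M g -> (1 <= t < T1 M)%N -> 0 < reach_prob g t ->
  optimal_given_state t g <->
  cost_given_thr t (xi g t) (thr g t) = least_cost t (xi g t) /\
  (0 < reach_prob g t.+1 -> optimal_given_state t.+1 g).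
Proof.
move=> ga tT p0; have [t1 tlt] := andP tT.
have tle : (1 <= t <= T1 M)%N by rewrite t1 ltnW.
have tS : (1 <= t.+1 <= T1 M)%N by [].
have gA : in_state t (xi g t) g by split.
have := @inner_inf_minimal R _ _ (in_state t (xi g t))
  [set a : thresholds R | ordered a] (fun k => thr k t) (V^~ t) g.
have V0 k : 0 <= V k t by exact: cost_to_go_ge0.
move=> /(_ (fun k _ => V0 k)).
move=> /(_ (fun k kA => let: And3 ka _ _ := kA in ka.1 t tT)).
move=> /(_ (fun a oa => set_thr_in_state tT ga p0 oa) gA) /= H.
rewrite -/(cost_given_thr _ _ _) in H.
set m := xi g t [set x | rule M g t x.2 = None].
set S := stage_cost M wald t (xi g t) (rule M g t).
have VE k : in_state t (xi g t) k -> thr k t = thr g t ->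
    V k t = S + m * V k t.+1.
  move=> [ka k0 kxi] kt; rewrite (cost_to_go_step hpi wald tle k0) kxi.
  by rewrite (rule_thr tlt kt).
have reachS k : in_state t (xi g t) k -> thr k t = thr g t ->
    (0 < reach_prob k t.+1) = (0 < m).
  move=> [ka k0 kxi] kt; rewrite (reach_prob_gt0S hpi tle k0) kxi.
  by rewrite (rule_thr tlt kt).
split=> [bg|[gopt bS]].
  split.
    apply/H => k kA; apply: le_trans (bg k kA).
    apply: ge_inf; last by exists g.
    by exists 0 => _ [k' _ <-]; exact: V0.
  move=> p1 k kA; have [ka _ _] := kA.
  (* Compare [g] with the policy which follows [g] up to [t] and [k] after. *)
  have KE := cost_to_go_glue tS p1 ga kA.
  have Kpast : same_past g (glue g k t.+1) t.
    by move=> s /andP[_ st] /=; rewrite (ltn_trans st).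
  have KA : in_state t (xi g t) (glue g k t.+1).
    split; first exact: glue_admissible.
      by rewrite -(reach_prob_past (ltnW tlt) Kpast).
    by apply/esym; exact: (xi_law_same_past pi tle Kpast).
  have Kt : thr (glue g k t.+1) t = thr g t by rewrite /= ltnSn.
  have := bg _ KA; rewrite (VE g gA erefl) (VE _ KA Kt) KE lerD2l ler_pM2l//.
  by rewrite -(reachS g gA erefl).
move/H: gopt => gopt k kA; apply: le_trans (gopt k kA).
apply: lb_le_inf; first by exists (V g t), g.
move=> _ [k' [kA' kt'] <-]; rewrite (VE g gA erefl) (VE k' kA' kt') lerD2l.
have [m0|m0] := boolP (0 < m).
  have p1 : 0 < reach_prob g t.+1 by rewrite (reachS g gA erefl).
  rewrite ler_pM2l//; apply: bS => //; have [ka' k0' kxi'] := kA'; split => //.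
    by rewrite (reachS k' kA' kt').
  by apply: (xi_step hpi tT).
have -> : m = 0.
  by apply/eqP; move: m0; rewrite lt0r xi_silent_ge0 andbT negbK.
by rewrite !mul0r.
Qed.

Lemma optimal_given_state_iff g t :
  admissible1 M g -> (1 <= t <= T1 M)%N -> 0 < reach_prob g t ->
  optimal_given_state t g <->
  (forall s, (t <= s < T1 M)%N -> 0 < reach_prob g s ->
     cost_given_thr s (xi g s) (thr g s) = least_cost s (xi g s)) /\
  (0 < reach_prob g (T1 M) ->
     cost_given_last (xi g (T1 M)) (last_thr g) = least_last_cost (xi g (T1 M))).
Proof.
move=> ga; have [n] := ubnP (T1 M - t)%N; elim: n t => // n IH t tn tT p0.
have [t1] := andP tT; rewrite leq_eqVlt => /orP[/eqP tE|tlt].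
  rewrite tE in p0 *; split=> [/(optimal_given_state_end ga p0) last_opt|[_ last_opt]].
    by split=> // s /andP[Ts sT]; move: (leq_ltn_trans Ts sT); rewrite ltnn.
  by apply/(optimal_given_state_end ga p0); exact: last_opt.
have tT' : (1 <= t < T1 M)%N by rewrite t1.
have IHS := IH t.+1 _ _ _.
have nlt : (T1 M - t.+1 < n)%N by rewrite subnS -ltnS prednK ?subn_gt0.
split=> [/(optimal_given_state_step ga tT' p0)[optt bS]|[opts optT]].
  (* A later time which is reached can only be reached through [t.+1]. *)
  have later s : (t <= s)%N -> (s <= T1 M)%N -> 0 < reach_prob g s ->
      t = s \/ 0 < reach_prob g t.+1.
    rewrite leq_eqVlt => /orP[/eqP->|ts sT ps]; [by left|right].
    by apply: lt_le_trans ps _; apply: (reach_prob_mono hpi); rewrite ?ts// leqW.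
  split=> [s /andP[ts sT] ps|pT].
    have [<-//|p1] := later s ts (ltnW sT) ps.
    have [ts'|ts'] := ltnP t s.
      by have [/(_ (bS p1))[+ _] _] := IHS nlt tlt p1; apply => //; rewrite ts'.
    have <- // : t = s by apply/eqP; rewrite eqn_leq ts ts'.
  have [tE|p1] := later (T1 M) (ltnW tlt) (leqnn _) pT.
    by rewrite tE ltnn in tlt.
  by have [/(_ (bS p1))[_ +] _] := IHS nlt tlt p1; apply.
apply/(optimal_given_state_step ga tT' p0); split; first by apply: opts => //; rewrite leqnn.
move=> p1; apply/(IHS nlt tlt p1); split=> // s /andP[ts sT].
by apply: opts; rewrite (ltnW ts).
Qed.

Lemma cost_given_thr_ge0 t l a : (1 <= t)%N -> 0 <= cost_given_thr t l a.
Proof. by move=> t1; apply: inf_ge0 => _ [k _ <-]; exact: cost_to_go_ge0. Qed.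

Lemma cost_given_last_ge0 l a : 0 <= cost_given_last l a.
Proof.
by apply: inf_ge0 => _ [k _ <-]; apply: cost_to_go_ge0 => //; exact: T1_gt0.
Qed.

End optimal_policies.

Theorem theorem5 (R : realType) (d d1 d2 : measure_display)
    (Omega : measurableType d) (Y1 : measurableType d1)
    (Y2 : measurableType d2) (M : model R Omega Y1 Y2)
    (pi : forall t, t.-tuple Y1 -> R) (hpi : is_belief1 M pi)
    (wald : R -> policy2 Y2) (hwald : is_wald_policy M wald) :
  exists (cR : nat -> joint_law_type R -> thresholds R -> R)
         (cRstar : nat -> joint_law_type R -> R)
         (cRT : joint_law_type R -> R -> R)
         (cRTstar : joint_law_type R -> R),
    [/\ (forall t l, (1 <= t < T1 M)%N ->
           (cRstar t l)%:E =
           ereal_inf [set (cR t l a)%:E | a in [set a | ordered a]]),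
        (forall l, (cRTstar l)%:E =
           ereal_inf [set (cRT l a)%:E | a in [set a | 0 <= a <= 1]]),
        [/\ (forall g, xi_law M pi g 1 = cond_law M pi setT 1),
            (forall g g' t z, (1 <= t < T1 M)%N ->
               xi_law M pi g t = xi_law M pi g' t -> thr g t = thr g' t ->
               eta_law M pi g t z = eta_law M pi g' t z),
            (forall g g' t, (1 <= t < T1 M)%N ->
               eta_law M pi g t None = eta_law M pi g' t None ->
               xi_law M pi g t.+1 = xi_law M pi g' t.+1) &
            (forall g g' t, (1 <= t <= T1 M)%N -> same_past g g' t ->
               xi_law M pi g t = xi_law M pi g' t)] &
        forall g t, admissible1 M g -> (1 <= t <= T1 M)%N ->
          reachable M pi g t ->
          (optimal_from M pi wald g t <->
           (forall s, (t <= s < T1 M)%N -> reachable M pi g s ->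
              cR s (xi_law M pi g s) (thr g s) = cRstar s (xi_law M pi g s)) /\
           (reachable M pi g (T1 M) ->
              cRT (xi_law M pi g (T1 M)) (last_thr g) = cRTstar (xi_law M pi g (T1 M))))].
Proof.
exists (cost_given_thr M pi wald), (least_cost M pi wald).
exists (cost_given_last M pi wald), (least_last_cost M pi wald); split.
- move=> t l /andP[t1 _].
  apply: (ereal_inf_image (a := Thresholds 0 0 0 0)) => [|a].
    by split; rewrite //= ler01.
  by apply: cost_given_thr_ge0.
- move=> l; apply: (ereal_inf_image (a := 0)) => [|a]; first by rewrite /= lexx ler01.
  by apply: cost_given_last_ge0.
- split.
  + exact: xi_law1.
  + by move=> g g' t z; exact: (eta_law_eq hpi).
  + by move=> g g' t tT; exact: (xi_law_eta hpi tT).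
  + by move=> g g' t; exact: xi_law_same_past.
- move=> g t ga tT /(reachableE hpi g (proj2 (andP tT))) p0.
  apply: (iff_trans (optimal_from_state hpi hwald ga tT p0)).
  apply: (iff_trans (optimal_given_state_iff hpi wald ga tT p0)).
  have reachP s : (s <= T1 M)%N -> reachable M pi g s <-> 0 < reach_prob M pi g s.
    exact: (reachableE hpi).
  split=> -[opts optT]; split=> [s sT rs|rT].
  + by apply: opts => //; apply/reachP => //; case/andP: sT => _ /ltnW.
  + by apply: optT; apply/reachP.
  + by apply: opts => //; apply/reachP => //; case/andP: sT => _ /ltnW.
  + by apply: optT; apply/reachP.
Qed.
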